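(* Let $n\ge 3$ be an integer, $0<m\le \frac{n-2}{n}$, $\eta>0$, and let $\alpha,\beta\in\mathbb{R}$ satisfy $\beta>0$ and $\alpha\le \frac{\beta(n-2)}{m}$. Then there exists a unique solution $v$ of $$\frac{n-1}{m}\left((v^m)''+\frac{n-1}{r}(v^m)'\right)+\alpha v+\beta r v'=0,\quad v>0,\quad\text{in }(0,\infty),$$ with $$v(0)=\eta,\qquad v'(0)=0.$$ Moreover, if $\alpha\neq 0$ and $k=\beta/\alpha$, then the function $w_1(r)=r^2v(r)^{2k}$ satisfies $w_1'(r)>0$ for all $r>0$.
   Context: A solution means a positive function $v$ on $[0,\infty)$ that is $C^1$ on $[0,\infty)$, $C^2$ on $(0,\infty)$, satisfies the ordinary differential equation classically on $(0,\infty)$ and takes the prescribed values of $v$ and $v'$ at $r=0$. Primes denote $d/dr$. (The equation is the radial form of $\frac{n-1}{m}\Delta v^m+\alpha v+\beta x\cdot\nabla v=0$, $v>0$, in $\mathbb{R}^n$, $v(0)=\eta$.) *)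

(* Defs.v *)
From Stdlib Require Import Reals.
From Coquelicot Require Import Coquelicot.
Open Scope R_scope.

Definition half_line (r : R) : Prop := 0 <= r.

(* Derivative relative to a domain: one-sided at an endpoint of [D], and the
   usual derivative at interior points. *)
Definition is_derive_in (D : R -> Prop) (f : R -> R) (x l : R) : Prop :=
  filterdiff f (within D (locally x)) (fun h : R => scal h l).

Definition C1_in (D : R -> Prop) (f : R -> R) : Prop :=
  exists df : R -> R,
    (forall x : R, D x -> is_derive_in D f x (df x)) /\ continuous_on D df.

(* Meant for open [D], where [Derive_n] only depends on [f] inside [D]. *)
Definition C2_open (D : R -> Prop) (f : R -> R) : Prop :=
  forall x : R, D x ->
    (forall i : nat, (i <= 2)%nat -> ex_derive_n f i x) /\
    continuous (Derive_n f 2) x.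

(* A function on [0, oo) is represented by a total function whose values at
   negative arguments are irrelevant. [Rpower x y] is the usual real power
   since its base is positive here. *)
Definition is_solution (n : nat) (m alpha beta eta : R) (v : R -> R) : Prop :=
  (forall r : R, 0 <= r -> 0 < v r) /\
  C1_in half_line v /\
  C2_open (Rlt 0) v /\
  (forall r : R, 0 < r ->
    (INR n - 1) / m *
      (Derive_n (fun s : R => Rpower (v s) m) 2 r
       + (INR n - 1) / r * Derive (fun s : R => Rpower (v s) m) r)
    + alpha * v r + beta * r * Derive v r = 0) /\
  v 0 = eta /\
  is_derive_in half_line v 0 0.

(* Main.v *)
Require Import Defs.
From Stdlib Require Import Reals Lra Lia.
From Coquelicot Require Import Coquelicot.
Open Scope R_scope.

(** Put f = ln v and g = f'.  Dividing the equation by (n-1) v^m turns it into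

      g' = - (n-1)/r g - m g^2 - E(f) (alpha + beta r g),
      E(f) = exp((1-m) f) / (n-1),   f(0) = ln eta,   g(0) = 0,

    and w1 is increasing exactly where 1 + (beta/alpha) r g > 0.  For alpha = 0
    the solution is constant.  Otherwise write alpha = s a with s = 1 or s = -1
    and a > 0, and put c = a/beta and h = - s g; the claim on w1 is r h < c.

    The heart of the matter is that the region 0 <= r h <= c is invariant.  On
    h = 0 the equation gives h' = E a > 0.  On r h = c the factor a - beta r h
    vanishes, and what remains is r (r h)' = c (s m c - (n-2)), which is
    nonpositive precisely because alpha <= beta (n-2)/m.  In this region
    |f'| <= c/r, so f stays finite for all r and the solution is global.
    Equality r h = c is never reached: c - r h satisfies a linear differential
    inequality and is positive at 0 ([weighted_slope_lt]).

    Existence.  The singular coefficient is a damping: the solution of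
    h' = - (j/r) h + H with h(0) = 0 is the average r^-j int_0^r x^j H, whose
    kernel is at most 1 ([damped]).  So the system is a Volterra equation for h
    alone, with f recovered by integration, and Picard iteration applies
    ([volterra_fixed_point]) as soon as the nonlinearity is Lipschitz on bounded
    intervals of r.  To ensure this, h is replaced inside the nonlinearity by
    its truncation to the interval from 0 to c / max(r, r1).  For a suitable r1
    the barriers 0, (c / r1^2) r on [0, r1] and c/r on [r1, oo) show that the
    truncation is not active on the fixed point ([trunc_slope_bounds]), which
    therefore solves the original system on the whole half-line.

    Uniqueness.  For two solutions, the derivative of the energy
    (f1 - f2)^2 + (g1 - g2)^2 is at most a constant times the energy on bounded
    intervals, because the singular term contributes with a negative sign; the
    energy vanishes at 0, hence everywhere ([log_profile_unique]). *)

(** * Continuous functions on the line, derivatives and primitives *)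

Definition cont (f : R -> R) : Prop := forall x, continuous f x.

Lemma cont_ex_RInt (f : R -> R) (a b : R) : cont f -> ex_RInt f a b.
Proof. intros Hf. apply (ex_RInt_continuous (V := R_CompleteNormedModule)). intros; apply Hf. Qed.

Lemma cont_ext (f g : R -> R) : (forall x, f x = g x) -> cont f -> cont g.
Proof. intros E Hf x. apply (continuous_ext f); auto. Qed.

Lemma cont_const (c : R) : cont (fun _ => c).
Proof. intros x. apply continuous_const. Qed.

Lemma cont_id : cont (fun x => x).
Proof. intros x. apply continuous_id. Qed.

Lemma cont_plus (f g : R -> R) : cont f -> cont g -> cont (fun x => f x + g x).
Proof. intros Hf Hg x. apply (continuous_plus f g); auto. Qed.

Lemma cont_minus (f g : R -> R) : cont f -> cont g -> cont (fun x => f x - g x).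
Proof. intros Hf Hg x. apply (continuous_minus f g); auto. Qed.

Lemma cont_mult (f g : R -> R) : cont f -> cont g -> cont (fun x => f x * g x).
Proof. intros Hf Hg x. apply (continuous_mult f g); auto. Qed.

Lemma cont_comp (f g : R -> R) : cont f -> cont g -> cont (fun x => g (f x)).
Proof. intros Hf Hg x. apply (continuous_comp f g); auto. Qed.

Lemma cont_Rabs : cont Rabs.
Proof. intros x. apply continuous_Rabs. Qed.

Lemma cont_abs (f : R -> R) : cont f -> cont (fun x => Rabs (f x)).
Proof. intros Hf. apply (cont_comp f Rabs Hf cont_Rabs). Qed.

Lemma cont_exp : cont exp.
Proof. intros x. apply continuous_exp. Qed.

Lemma cont_pow (j : nat) : cont (fun x => x ^ j).
Proof.
  induction j as [|j IH]; simpl; [apply cont_const|].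
  apply cont_mult; [apply cont_id | exact IH].
Qed.

Lemma cont_inv (f : R -> R) :
  cont f -> (forall x, f x <> 0) -> cont (fun x => / f x).
Proof. intros Hf H0 x. apply (continuous_comp f Rinv); [apply Hf | apply continuous_Rinv, H0]. Qed.

Lemma cont_Rmax (f g : R -> R) : cont f -> cont g -> cont (fun x => Rmax (f x) (g x)).
Proof.
  intros Hf Hg.
  apply (cont_ext (fun x => (f x + g x + Rabs (f x - g x)) * / 2)).
  - intros x. unfold Rmax, Rabs. destruct (Rle_dec _ _), (Rcase_abs _); lra.
  - apply cont_mult; [|apply cont_const].
    apply cont_plus; [now apply cont_plus|].
    apply (cont_comp (fun x => f x - g x)); [now apply cont_minus | apply cont_Rabs].
Qed.

Lemma cont_Rmin (f g : R -> R) : cont f -> cont g -> cont (fun x => Rmin (f x) (g x)).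
Proof.
  intros Hf Hg.
  apply (cont_ext (fun x => f x + g x - Rmax (f x) (g x))).
  - intros x. unfold Rmax, Rmin. destruct (Rle_dec _ _); lra.
  - apply cont_minus; [now apply cont_plus | now apply cont_Rmax].
Qed.

Lemma is_derive_continuous (f : R -> R) (x l : R) : is_derive f x l -> continuous f x.
Proof. intros H. apply (ex_derive_continuous (K := R_AbsRing) (V := R_NormedModule)). now exists l. Qed.

Lemma is_derive_prod (f g : R -> R) (x f' g' : R) :
  is_derive f x f' -> is_derive g x g' ->
  is_derive (fun t => f t * g t) x (f' * g x + f x * g').
Proof. intros Hf Hg. apply (is_derive_mult f g x f' g' Hf Hg). intros; apply Rmult_comm. Qed.

Lemma is_derive_cmult (f : R -> R) (x c l : R) :
  is_derive f x l -> is_derive (fun t => c * f t) x (c * l).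
Proof. intros H. exact (is_derive_scal f x c l H). Qed.

Lemma is_derive_sub (f g : R -> R) (x f' g' : R) :
  is_derive f x f' -> is_derive g x g' -> is_derive (fun t => f t - g t) x (f' - g').
Proof. intros Hf Hg. exact (is_derive_minus f g x f' g' Hf Hg). Qed.

Lemma is_derive_power (k : nat) (x : R) :
  is_derive (fun t => t ^ S k) x ((INR k + 1) * x ^ k).
Proof. auto_derive; trivial. change (1 * (INR (S k) * x ^ k) = (INR k + 1) * x ^ k). rewrite S_INR. ring. Qed.

Lemma is_derive_primitive (f : R -> R) (x : R) :
  cont f -> is_derive (fun r => RInt f 0 r) x (f x).
Proof.
  intros Hf. apply (is_derive_RInt f _ 0); [|apply Hf].
  apply filter_forall. intros y. apply (RInt_correct (V := R_CompleteNormedModule)), cont_ex_RInt, Hf.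
Qed.

Lemma cont_primitive (f : R -> R) : cont f -> cont (fun r => RInt f 0 r).
Proof. intros Hf x. eapply is_derive_continuous, is_derive_primitive, Hf. Qed.

Lemma RInt_Rmult (f : R -> R) (a b c : R) :
  cont f -> RInt (fun x => c * f x) a b = c * RInt f a b.
Proof. intros Hf. apply (RInt_scal f a b c). now apply cont_ex_RInt. Qed.

Lemma cont_bounded (f : R -> R) (b : R) :
  0 <= b -> cont f -> exists M, 0 <= M /\ forall x, 0 <= x <= b -> Rabs (f x) <= M.
Proof.
  intros Hb Hf.
  destruct (continuity_ab_maj (fun x => Rabs (f x)) 0 b Hb) as [M [HM _]].
  - intros c _. apply continuity_pt_filterlim.
    apply (cont_comp f Rabs Hf cont_Rabs).
  - exists (Rabs (f M)). split; [apply Rabs_pos | exact HM].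
Qed.

(** * Comparison principles *)

(** The derivative is only required inside the interval, so that the lemma
    applies across the singular point r = 0. *)
Lemma derive_le0_decr (f df : R -> R) (a b : R) :
  a <= b -> (forall x, a <= x <= b -> continuous f x) ->
  (forall x, a < x < b -> is_derive f x (df x) /\ df x <= 0) -> f b <= f a.
Proof.
  intros Hab Hc Hd.
  set (dg := fun x => if Rlt_dec a x then if Rlt_dec x b then df x else 0 else 0).
  destruct (MVT_gen f a b dg) as [c [_ E]].
  - rewrite Rmin_left, Rmax_right by lra. intros x Hx. unfold dg.
    destruct (Rlt_dec a x); [|lra]. destruct (Rlt_dec x b); [|lra]. now apply Hd.
  - rewrite Rmin_left, Rmax_right by lra. intros x Hx.
    apply continuity_pt_filterlim, Hc, Hx.
  - assert (dg c <= 0).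
    { unfold dg. destruct (Rlt_dec a c); [|lra]. destruct (Rlt_dec c b); [|lra].
      now apply Hd. }
    nra.
Qed.

(** After the last point of [a, b] where d <= 0, a positive excursion of d would
    begin, and d cannot increase along it. *)
Lemma barrier (d d' : R -> R) (a b : R) :
  a <= b -> (forall x, a <= x <= b -> continuous d x) ->
  (forall x, a < x < b -> is_derive d x (d' x)) ->
  (forall x, a < x < b -> 0 < d x -> d' x <= 0) -> d a <= 0 -> d b <= 0.
Proof.
  intros Hab Hc Hd Hs Ha. apply Rnot_lt_le. intros Hb.
  set (E := fun x => a <= x <= b /\ d x <= 0).
  destruct (completeness E) as [z [Hz1 Hz2]].
  { exists b. intros x [Hx _]. lra. }
  { exists a. split; [lra | exact Ha]. }
  assert (Haz : a <= z) by (apply Hz1; split; [lra | exact Ha]).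
  assert (Hzb : z <= b) by (apply Hz2; intros x [Hx _]; lra).
  assert (Hpos : forall x, z < x <= b -> 0 < d x).
  { intros x Hx. apply Rnot_le_lt. intros H.
    assert (x <= z) by (apply Hz1; split; [lra | exact H]). lra. }
  assert (Hdz : d z <= 0).
  { apply Rnot_lt_le. intros H.
    assert (Hcz := Hc z (conj Haz Hzb)).
    apply filterlim_locally with (eps := mkposreal _ H) in Hcz.
    destruct Hcz as [e He].
    assert (z <= z - e).
    { apply Hz2. intros x [Hx Hdx]. apply Rnot_lt_le. intros Hlt.
      assert (x <= z) by (apply Hz1; split; [lra | exact Hdx]).
      assert (Hball : ball z e x).
      { change (Rabs (x - z) < e). apply Rabs_def1; lra. }
      specialize (He x Hball). change (Rabs (d x - d z) < d z) in He.
      apply Rabs_def2 in He. lra. }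
    destruct e as [e He0]; simpl in *; lra. }
  assert (d b <= d z).
  { apply (derive_le0_decr d d'); [exact Hzb | intros; apply Hc; lra |].
    intros x Hx. split; [apply Hd; lra | apply Hs; [lra | apply Hpos; lra]]. }
  lra.
Qed.

(** The function d exp (- K (x - a)) is nonincreasing.  Applied to - d, the lemma
    gives lower bounds. *)
Lemma gronwall (d d' : R -> R) (K a b : R) :
  a <= b -> (forall x, a <= x <= b -> continuous d x) ->
  (forall x, a < x < b -> is_derive d x (d' x) /\ d' x <= K * d x) ->
  d b <= d a * exp (K * (b - a)).
Proof.
  intros Hab Hc Hd.
  assert (He : forall x, is_derive (fun t => exp (- K * (t - a))) x
                 (- K * exp (- K * (x - a)))).
  { intros x. auto_derive; trivial. unfold Rminus. ring. }
  assert (H : d b * exp (- K * (b - a)) <= d a * exp (- K * (a - a))).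
  { apply (derive_le0_decr (fun t => d t * exp (- K * (t - a)))
      (fun x => d' x * exp (- K * (x - a)) + d x * (- K * exp (- K * (x - a)))));
      [exact Hab | |].
    - intros x Hx. apply (continuous_mult d); [now apply Hc|].
      eapply is_derive_continuous, He.
    - intros x Hx. destruct (Hd x Hx) as [Hdx Hle]. split.
      + exact (is_derive_prod d _ x _ _ Hdx (He x)).
      + assert (Hp := exp_pos (- K * (x - a))). nra. }
  replace (- K * (a - a)) with 0 in H by ring. rewrite exp_0, Rmult_1_r in H.
  assert (Hi : exp (- K * (b - a)) * exp (K * (b - a)) = 1).
  { rewrite <- exp_plus. replace (_ + _) with 0 by ring. apply exp_0. }
  assert (Hp := exp_pos (K * (b - a))).
  replace (d b) with (d b * exp (- K * (b - a)) * exp (K * (b - a))).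
  - apply Rmult_le_compat_r; lra.
  - rewrite Rmult_assoc, Hi. ring.
Qed.

(** * Fixed points of Volterra operators *)

Lemma half_pow_small (A eps : R) : 0 < eps -> exists k : nat, A * (/ 2) ^ k < eps.
Proof.
  intros He. assert (HA := Rabs_pos A).
  destruct (pow_lt_1_zero (/ 2)) with (y := eps / (Rabs A + 1)) as [k Hk].
  - rewrite Rabs_pos_eq; lra.
  - apply Rdiv_lt_0_compat; lra.
  - exists k. specialize (Hk k (le_n k)).
    assert (Hp : 0 < (/ 2) ^ k) by (apply pow_lt; lra).
    rewrite Rabs_pos_eq in Hk by lra.
    apply (Rmult_lt_compat_r (Rabs A + 1)) in Hk; [|lra].
    replace (eps / (Rabs A + 1) * (Rabs A + 1)) with eps in Hk by (field; lra).
    assert (A <= Rabs A) by apply Rle_abs. nra.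
Qed.

(** Picard iteration.  In the weight exp (2 C r) the iterates contract by the
    factor 1/2 on each [0, b], because C times the integral of exp (2 C x) over
    [0, r] is at most half of exp (2 C r).  Hence no smallness of b is needed, and
    a single sequence of iterates serves all b at once. *)
Lemma volterra_fixed_point (Phi : (R -> R) -> R -> R) :
  (forall h, cont h -> cont (Phi h)) ->
  (forall b, 0 <= b -> exists C, 0 <= C /\
     forall h1 h2, cont h1 -> cont h2 -> forall r, 0 <= r <= b ->
       Rabs (Phi h1 r - Phi h2 r) <= C * RInt (fun x => Rabs (h1 x - h2 x)) 0 r) ->
  exists h, cont h /\ forall r, 0 <= r -> Phi h r = h r.
Proof.
  intros Hc Hl.
  set (g := fun k => Nat.iter k Phi (fun _ => 0)).
  assert (Hg : forall k, cont (g k)).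
  { induction k as [|k IH]; [apply cont_const | now apply (Hc (g k))]. }
  assert (Hpos : forall k, 0 < (/ 2) ^ k) by (intros; apply pow_lt; lra).
  assert (Hstep : forall b, 0 <= b -> exists N, 0 <= N /\ forall k r, 0 <= r <= b ->
            Rabs (g (S k) r - g k r) <= N * (/ 2) ^ k).
  { intros b Hb. destruct (Hl b Hb) as [C [HC HL]].
    destruct (cont_bounded (fun x => g 1%nat x - g 0%nat x) b Hb) as [M [HM HMb]].
    { apply cont_minus; apply Hg. }
    assert (Hk : forall k r, 0 <= r <= b ->
              Rabs (g (S k) r - g k r) <= M * (/ 2) ^ k * exp (2 * C * r)).
    { induction k as [|k IH]; intros r Hr.
      - assert (1 <= exp (2 * C * r)).
        { rewrite <- exp_0. destruct (Req_dec (2 * C * r) 0) as [->|]; [lra|].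
          left. apply exp_increasing.
          assert (0 <= 2 * C * r) by (apply Rmult_le_pos; lra). lra. }
        specialize (HMb r Hr). rewrite pow_O. nra.
      - change (g (S (S k))) with (Phi (g (S k))).
        change (g (S k)) with (Phi (g k)) at 2.
        eapply Rle_trans; [apply HL; auto|].
        assert (Hint : is_RInt (fun x => M * (/ 2) ^ k * (C * exp (2 * C * x))) 0 r
                  (M * (/ 2) ^ k * ((exp (2 * C * r) - 1) * / 2))).
        { replace (M * (/ 2) ^ k * ((exp (2 * C * r) - 1) * / 2)) with
            (minus (M * (/ 2) ^ k * (exp (2 * C * r) * / 2))
                   (M * (/ 2) ^ k * (exp (2 * C * 0) * / 2))).
          2:{ unfold minus, plus, opp; simpl. rewrite Rmult_0_r, exp_0. ring. }
          apply (is_RInt_derive (fun x => M * (/ 2) ^ k * (exp (2 * C * x) * / 2))).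
          - intros x _. auto_derive; trivial. field.
          - intros x _.
            apply (cont_mult (fun _ => M * (/ 2) ^ k) (fun x => C * exp (2 * C * x))).
            + apply cont_const.
            + apply cont_mult; [apply cont_const|].
              apply (cont_comp (fun x => 2 * C * x) exp); [|apply cont_exp].
              apply cont_mult; [apply cont_const | apply cont_id]. }
        apply Rle_trans with (C * RInt (fun x => M * (/ 2) ^ k * exp (2 * C * x)) 0 r).
        + apply Rmult_le_compat_l; [exact HC|]. apply RInt_le; [lra | | |].
          * apply cont_ex_RInt. apply (cont_comp (fun x => g (S k) x - g k x) Rabs).
            -- apply cont_minus; apply Hg.
            -- apply cont_Rabs.
          * apply cont_ex_RInt, cont_mult; [apply cont_const|].
            apply (cont_comp (fun x => 2 * C * x) exp); [|apply cont_exp].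
            apply cont_mult; [apply cont_const | apply cont_id].
          * intros x Hx. apply IH. lra.
        + rewrite <- RInt_Rmult.
          2:{ apply cont_mult; [apply cont_const|].
            apply (cont_comp (fun x => 2 * C * x) exp); [|apply cont_exp].
            apply cont_mult; [apply cont_const | apply cont_id]. }
          rewrite (RInt_ext _ (fun x => M * (/ 2) ^ k * (C * exp (2 * C * x)))).
          2:{ intros x _. simpl. ring. }
          rewrite (is_RInt_unique _ _ _ _ Hint).
          change ((/ 2) ^ S k) with (/ 2 * (/ 2) ^ k).
          assert (0 <= M * (/ 2) ^ k) by (apply Rmult_le_pos; [lra | left; apply Hpos]).
          lra. }
    exists (M * exp (2 * C * b)). split.
    { apply Rmult_le_pos; [lra | left; apply exp_pos]. }
    intros k r Hr. eapply Rle_trans; [apply Hk, Hr|].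
    assert (exp (2 * C * r) <= exp (2 * C * b)).
    { destruct (Req_dec (2 * C * r) (2 * C * b)) as [->|]; [lra|].
      left. apply exp_increasing.
      assert (2 * C * r <= 2 * C * b) by (apply Rmult_le_compat_l; lra). lra. }
    assert (0 <= M * (/ 2) ^ k) by (apply Rmult_le_pos; [lra | left; apply Hpos]).
    nra. }
  assert (Hcauchy : forall b, 0 <= b -> exists N, 0 <= N /\ forall k j r, 0 <= r <= b ->
            Rabs (g (k + j)%nat r - g k r) <= N * (/ 2) ^ k).
  { intros b Hb. destruct (Hstep b Hb) as [N [HN HNb]].
    exists (2 * N). split; [lra|]. intros k j r Hr.
    assert (H : Rabs (g (k + j)%nat r - g k r) <= 2 * N * ((/ 2) ^ k - (/ 2) ^ (k + j))).
    { induction j as [|j IH].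
      - rewrite Nat.add_0_r. unfold Rminus. rewrite !Rplus_opp_r, Rabs_R0. lra.
      - rewrite <- plus_n_Sm. specialize (HNb (k + j)%nat r Hr).
        assert (Ht := Rabs_triang (g (S (k + j)) r - g (k + j)%nat r)
                                  (g (k + j)%nat r - g k r)).
        replace (g (S (k + j)) r - g (k + j)%nat r + (g (k + j)%nat r - g k r))
          with (g (S (k + j)) r - g k r) in Ht by ring.
        change ((/ 2) ^ S (k + j)) with (/ 2 * (/ 2) ^ (k + j)). lra. }
    assert (0 <= N * (/ 2) ^ (k + j)) by (apply Rmult_le_pos; [lra | left; apply Hpos]).
    lra. }
  set (h := fun r => real (Lim_seq (fun k => g k (Rmax 0 r)))).
  assert (Hlim : forall r, 0 <= r -> is_lim_seq (fun k => g k r) (h r)).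
  { intros r Hr. unfold h. rewrite Rmax_right by exact Hr.
    apply Lim_seq_correct', ex_lim_seq_cauchy_corr. intros eps.
    destruct (Hcauchy r Hr) as [N [HN HNb]].
    destruct (half_pow_small (2 * N) eps (cond_pos eps)) as [k Hk].
    exists k. intros p q Hp Hq.
    assert (H1 := HNb k (p - k)%nat r ltac:(lra)).
    assert (H2 := HNb k (q - k)%nat r ltac:(lra)).
    replace (k + (p - k))%nat with p in H1 by lia.
    replace (k + (q - k))%nat with q in H2 by lia.
    apply Rabs_le_between in H1. apply Rabs_le_between in H2.
    apply Rabs_def1; lra. }
  assert (Hunif : forall b, 0 <= b -> exists N, 0 <= N /\ forall k r, 0 <= r <= b ->
            Rabs (h r - g k r) <= N * (/ 2) ^ k).
  { intros b Hb. destruct (Hcauchy b Hb) as [N [HN HNb]].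
    exists N. split; [exact HN|]. intros k r Hr.
    assert (Hq : is_lim_seq (fun j => Rabs (g (j + k)%nat r - g k r))
                   (Rabs (h r - g k r))).
    { apply (is_lim_seq_abs _ (h r - g k r)).
      apply is_lim_seq_minus'; [|apply is_lim_seq_const].
      apply (is_lim_seq_incr_n (fun j => g j r) k), Hlim. lra. }
    refine (is_lim_seq_le _ _ (Finite _) (Finite _) _ Hq (is_lim_seq_const (N * (/ 2) ^ k))).
    intros j. rewrite Nat.add_comm. now apply HNb. }
  assert (Hh0 : forall r, h r = h (Rmax 0 r)).
  { intros r. unfold h. f_equal. apply Lim_seq_ext. intros k. f_equal.
    rewrite (Rmax_right 0 (Rmax 0 r)); [reflexivity | apply Rmax_l]. }
  assert (Hh : cont h).
  { intros x. apply filterlim_locally. intros eps.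
    destruct (Hunif (Rabs x + 1)) as [N [HN HNb]].
    { assert (0 <= Rabs x) by apply Rabs_pos. lra. }
    destruct (half_pow_small (3 * N) eps (cond_pos eps)) as [k Hk].
    assert (He3 : 0 < eps / 3) by (assert (0 < eps) by apply cond_pos; lra).
    assert (Hgk : continuous (fun y => g k (Rmax 0 y)) x).
    { apply (cont_comp (fun y => Rmax 0 y) (g k)); [|apply Hg].
      apply cont_Rmax; [apply cont_const | apply cont_id]. }
    apply filterlim_locally with (eps := mkposreal _ He3) in Hgk.
    assert (H1 : locally x (fun y => Rabs (y - x) < 1)).
    { exists (mkposreal 1 Rlt_0_1). intros y Hy. exact Hy. }
    generalize (filter_and _ _ Hgk H1). apply filter_imp. intros y [Hy Hy1].
    change (Rabs (g k (Rmax 0 y) - g k (Rmax 0 x)) < eps / 3) in Hy.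
    change (Rabs (h y - h x) < eps).
    rewrite (Hh0 y), (Hh0 x).
    assert (Hx' : 0 <= Rmax 0 x <= Rabs x + 1).
    { split; [apply Rmax_l|]. apply Rmax_lub.
      - assert (0 <= Rabs x) by apply Rabs_pos. lra.
      - assert (x <= Rabs x) by apply Rle_abs. lra. }
    assert (Hy' : 0 <= Rmax 0 y <= Rabs x + 1).
    { split; [apply Rmax_l|]. apply Rmax_lub.
      - assert (0 <= Rabs x) by apply Rabs_pos. lra.
      - assert (x <= Rabs x) by apply Rle_abs. apply Rabs_def2 in Hy1. lra. }
    assert (Ha := HNb k _ Hx'). assert (Hb := HNb k _ Hy').
    apply Rabs_le_between in Ha. apply Rabs_le_between in Hb.
    apply Rabs_def2 in Hy. apply Rabs_def1; lra. }
  exists h. split; [exact Hh|]. intros r Hr.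
  destruct (Hunif r Hr) as [N [HN HNb]]. destruct (Hl r Hr) as [C [HC HL]].
  assert (Hbound : forall k, Rabs (Phi h r - h r) <= (C * r * N + N) * (/ 2) ^ k).
  { intros k. assert (H1 := HL h (g k) Hh (Hg k) r ltac:(lra)).
    assert (H2 := HNb (S k) r ltac:(lra)).
    change (g (S k) r) with (Phi (g k) r) in H2.
    assert (H3 : RInt (fun x => Rabs (h x - g k x)) 0 r <= r * (N * (/ 2) ^ k)).
    { assert (Hcd : cont (fun x => Rabs (h x - g k x))).
      { apply (cont_comp (fun x => h x - g k x) Rabs); [|apply cont_Rabs].
        apply cont_minus; [exact Hh | apply Hg]. }
      eapply Rle_trans; [apply Rle_abs|].
      eapply Rle_trans; [apply (abs_RInt_le_const _ 0 r (N * (/ 2) ^ k)); [exact Hr | |]|].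
      - now apply cont_ex_RInt.
      - intros t Ht. rewrite Rabs_Rabsolu. now apply HNb.
      - lra. }
    assert (H4 := Rmult_le_compat_l C _ _ HC H3).
    assert (H5 : N * (/ 2) ^ S k <= N * (/ 2) ^ k).
    { simpl. specialize (Hpos k). nra. }
    assert (H6 := Rabs_triang (Phi h r - Phi (g k) r) (Phi (g k) r - h r)).
    replace (Phi h r - Phi (g k) r + (Phi (g k) r - h r)) with (Phi h r - h r) in H6 by ring.
    rewrite (Rabs_minus_sym (Phi (g k) r)) in H6. lra. }
  apply Rminus_diag_uniq. apply Rabs_eq_0. apply Rle_antisym; [|apply Rabs_pos].
  apply le_epsilon. intros eps He.
  destruct (half_pow_small (C * r * N + N) eps He) as [k Hk].
  specialize (Hbound k). lra.
Qed.

(** * The damped integral *)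

(** The solution of h' = - (j/r) h + H on r > 0 that vanishes at 0, extended by 0
    to negative r in order to be continuous on the whole line. *)
Definition damped (j : nat) (H : R -> R) (r : R) : R :=
  RInt (fun x => x ^ j * H x) 0 (Rmax 0 r) / Rmax 0 r ^ j.

Lemma cont_damped_integrand (j : nat) (H : R -> R) :
  cont H -> cont (fun x => x ^ j * H x).
Proof. intros HH. apply cont_mult; [apply cont_pow | exact HH]. Qed.

Lemma damped_mult (j : nat) (H : R -> R) (r : R) :
  0 <= r -> r ^ j * damped j H r = RInt (fun x => x ^ j * H x) 0 r.
Proof.
  intros Hr. unfold damped. rewrite Rmax_right by exact Hr.
  destruct (Req_dec r 0) as [-> | Hr0].
  - rewrite RInt_point. unfold zero; simpl. unfold Rdiv. ring.
  - field. now apply pow_nonzero.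
Qed.

(** The weight x^j / r^j is at most 1 on [0, r]. *)
Lemma damped_bound (j : nat) (H : R -> R) (r : R) :
  cont H -> 0 <= r -> Rabs (damped j H r) <= RInt (fun x => Rabs (H x)) 0 r.
Proof.
  intros HH Hr. destruct (Req_dec r 0) as [-> | Hr0].
  - unfold damped. rewrite Rmax_left by lra. rewrite !RInt_point.
    unfold zero; simpl. unfold Rdiv. rewrite Rmult_0_l, Rabs_R0. lra.
  - assert (Hp : 0 < r ^ j) by (apply pow_lt; lra).
    apply (Rmult_le_reg_l (r ^ j)); [exact Hp|].
    rewrite <- (Rabs_pos_eq (r ^ j)) at 1 by lra.
    rewrite <- Rabs_mult, damped_mult by exact Hr.
    eapply Rle_trans.
    { apply abs_RInt_le; [exact Hr|]. apply cont_ex_RInt, cont_damped_integrand, HH. }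
    rewrite <- RInt_Rmult by (apply cont_abs, HH).
    apply RInt_le; [exact Hr | | |].
    + apply cont_ex_RInt, cont_abs, cont_damped_integrand, HH.
    + apply cont_ex_RInt, cont_mult; [apply cont_const | apply cont_abs, HH].
    + intros x Hx. rewrite Rabs_mult. apply Rmult_le_compat_r; [apply Rabs_pos|].
      rewrite Rabs_pos_eq by (apply pow_le; lra). apply pow_incr. lra.
Qed.

Lemma damped_minus (j : nat) (H1 H2 : R -> R) (r : R) :
  cont H1 -> cont H2 ->
  damped j H1 r - damped j H2 r = damped j (fun x => H1 x - H2 x) r.
Proof.
  intros C1 C2. unfold damped.
  rewrite (RInt_ext (fun x => x ^ j * (H1 x - H2 x))
                    (fun x => minus (x ^ j * H1 x) (x ^ j * H2 x))).
  - rewrite (RInt_minus (V := R_CompleteNormedModule));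
      try (apply cont_ex_RInt, cont_damped_integrand; assumption).
    unfold minus, plus, opp; simpl. unfold Rdiv. ring.
  - intros x _. unfold minus, plus, opp; simpl. ring.
Qed.

(** By [damped_mult], r^j times the damped integral is a primitive of r^j H. *)
Lemma is_derive_damped (j : nat) (H : R -> R) (r : R) :
  cont H -> 0 < r ->
  is_derive (damped j H) r (H r - INR j / r * damped j H r).
Proof.
  intros HH Hr.
  assert (Hloc : locally r (fun t => 0 < t)) by now apply open_gt.
  apply (is_derive_ext_loc (fun t => RInt (fun x => x ^ j * H x) 0 t * / t ^ j)).
  - revert Hloc. apply filter_imp. intros t Ht. unfold damped.
    rewrite Rmax_right by lra. reflexivity.
  - assert (Hrj : r ^ j <> 0) by (apply pow_nonzero; lra).
    assert (Hinv : is_derive (fun t => / t ^ j) r (- INR j / r * / r ^ j)).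
    { replace (- INR j / r * / r ^ j) with (- (INR j * r ^ pred j) / (r ^ j) ^ 2).
      - apply (is_derive_inv (fun t => t ^ j)); [|exact Hrj].
        replace (INR j * r ^ pred j) with (INR j * 1 * r ^ pred j) by ring.
        apply (is_derive_pow (fun t => t) j r 1), (is_derive_id (K := R_AbsRing)).
      - destruct j as [|j].
        + simpl. field. lra.
        + assert (r ^ j <> 0) by (apply pow_nonzero; lra).
          rewrite S_INR. simpl. field. repeat split; try assumption; lra. }
    assert (Hprim := is_derive_primitive _ r (cont_damped_integrand j H HH)).
    assert (Hprod := is_derive_prod _ _ r _ _ Hprim Hinv).
    replace (H r - INR j / r * damped j H r) with
      (r ^ j * H r * / r ^ j + RInt (fun x => x ^ j * H x) 0 r * (- INR j / r * / r ^ j)).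
    + exact Hprod.
    + rewrite <- damped_mult by lra. field. split; [lra | exact Hrj].
Qed.

(** At r = 0 the quotient is controlled by [damped_bound], whose right-hand side
    tends to 0. *)
Lemma cont_damped (j : nat) (H : R -> R) : cont H -> cont (damped j H).
Proof.
  intros HH x. destruct (Rlt_le_dec 0 x) as [Hx | Hx].
  - eapply is_derive_continuous, is_derive_damped; assumption.
  - assert (Heq : forall y, damped j H y = damped j H (Rmax 0 y)).
    { intros y. unfold damped. rewrite (Rmax_right 0 (Rmax 0 y)); [reflexivity | apply Rmax_l]. }
    assert (Hb : forall y, Rabs (damped j H y) <= RInt (fun x => Rabs (H x)) 0 (Rmax 0 y)).
    { intros y. rewrite Heq. apply damped_bound; [exact HH | apply Rmax_l]. }
    assert (HB : continuous (fun y => RInt (fun x => Rabs (H x)) 0 (Rmax 0 y)) x).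
    { apply (cont_comp (fun y => Rmax 0 y) (fun r => RInt (fun x => Rabs (H x)) 0 r)).
      - apply cont_Rmax; [apply cont_const | apply cont_id].
      - apply cont_primitive, cont_abs, HH. }
    assert (H0 : RInt (fun x => Rabs (H x)) 0 (Rmax 0 x) = 0).
    { rewrite Rmax_left by exact Hx. apply (RInt_point 0 (fun x => Rabs (H x))). }
    apply filterlim_locally. intros eps.
    apply filterlim_locally with (eps := eps) in HB. revert HB. apply filter_imp.
    intros y Hy.
    change (Rabs (RInt (fun x => Rabs (H x)) 0 (Rmax 0 y)
                  - RInt (fun x => Rabs (H x)) 0 (Rmax 0 x)) < eps) in Hy.
    change (Rabs (damped j H y - damped j H x) < eps).
    assert (Hbx := Hb x). assert (Hby := Hb y). rewrite H0 in *.
    apply Rabs_le_between in Hbx. apply Rabs_le_between in Hby.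
    apply Rabs_def2 in Hy. apply Rabs_def1; lra.
Qed.

(** * The truncated problem *)

Lemma Rmult3_le_pos (x y z : R) : 0 <= x -> 0 <= y -> 0 <= z -> 0 <= x * y * z.
Proof. intros Hx Hy Hz. apply Rmult_le_pos; [now apply Rmult_le_pos | exact Hz]. Qed.

Lemma sign_Rabs (s : R) : s = 1 \/ s = -1 -> Rabs s = 1.
Proof. intros [-> | ->]; unfold Rabs; destruct (Rcase_abs _); lra. Qed.

(** Convexity: exp y >= exp x (1 + (y - x)). *)
Lemma exp_lipschitz (B x y : R) :
  x <= B -> y <= B -> Rabs (exp x - exp y) <= exp B * Rabs (x - y).
Proof.
  assert (Hw : forall x y, y <= x -> x <= B -> Rabs (exp x - exp y) <= exp B * Rabs (x - y)).
  { clear. intros x y Hyx HxB.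
    assert (Hmono : forall u v, u <= v -> exp u <= exp v).
    { intros u v [Huv | ->]; [left; now apply exp_increasing | lra]. }
    assert (Hy := Hmono _ _ Hyx). assert (HB := Hmono _ _ HxB).
    rewrite !Rabs_pos_eq by lra.
    assert (Ht := exp_ineq1_le (y - x)).
    assert (Hprod : exp x * exp (y - x) = exp y).
    { rewrite <- exp_plus. f_equal. ring. }
    assert (Hx := exp_pos x). nra. }
  intros Hx Hy. destruct (Rle_dec y x) as [H | H]; [now apply Hw|].
  rewrite (Rabs_minus_sym (exp x)), (Rabs_minus_sym x). apply Hw; lra.
Qed.

(** The factor v^(1-m) / (n-1) of alpha + beta r g, for v = exp f and
    n = p + 2. *)
Definition reaction (p : nat) (m f : R) : R := exp ((1 - m) * f) / (INR p + 1).

Lemma reaction_pos (p : nat) (m f : R) : 0 < reaction p m f.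
Proof.
  apply Rdiv_lt_0_compat; [apply exp_pos|]. assert (H := pos_INR p). lra.
Qed.

(** The right-hand side depends on the distance from f to f0 only, so that one
    constant covers both signs of 1 - m and both directions in which f may move. *)
Lemma reaction_le (p : nat) (m f0 f d : R) :
  Rabs (f - f0) <= d ->
  reaction p m f <= exp ((1 - m) * f0 + Rabs (1 - m) * d) / (INR p + 1).
Proof.
  intros Hd. assert (H := pos_INR p). unfold reaction.
  apply Rmult_le_compat_r; [left; apply Rinv_0_lt_compat; lra|].
  assert (Hle : (1 - m) * f <= (1 - m) * f0 + Rabs (1 - m) * d).
  { assert (H1 : (1 - m) * (f - f0) <= Rabs (1 - m) * Rabs (f - f0)).
    { rewrite <- Rabs_mult. apply Rle_abs. }
    assert (H2 := Rmult_le_compat_l _ _ _ (Rabs_pos (1 - m)) Hd). lra. }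
  destruct Hle as [Hlt | ->]; [left; now apply exp_increasing | lra].
Qed.

Lemma reaction_lipschitz (p : nat) (m f0 f1 f2 d : R) :
  Rabs (f1 - f0) <= d -> Rabs (f2 - f0) <= d ->
  Rabs (reaction p m f1 - reaction p m f2) <=
    exp ((1 - m) * f0 + Rabs (1 - m) * d) / (INR p + 1) * Rabs (1 - m) * Rabs (f1 - f2).
Proof.
  intros H1 H2. assert (Hp := pos_INR p).
  assert (Hle : forall f, Rabs (f - f0) <= d ->
            (1 - m) * f <= (1 - m) * f0 + Rabs (1 - m) * d).
  { intros f Hf. assert (H3 : (1 - m) * (f - f0) <= Rabs (1 - m) * Rabs (f - f0)).
    { rewrite <- Rabs_mult. apply Rle_abs. }
    assert (H4 := Rmult_le_compat_l _ _ _ (Rabs_pos (1 - m)) Hf). lra. }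
  assert (He := exp_lipschitz _ _ _ (Hle f1 H1) (Hle f2 H2)).
  replace ((1 - m) * f1 - (1 - m) * f2) with ((1 - m) * (f1 - f2)) in He by ring.
  rewrite Rabs_mult in He. unfold reaction.
  replace (exp ((1 - m) * f1) / (INR p + 1) - exp ((1 - m) * f2) / (INR p + 1))
    with ((exp ((1 - m) * f1) - exp ((1 - m) * f2)) * / (INR p + 1)) by (field; lra).
  assert (Hi : 0 < / (INR p + 1)) by (apply Rinv_0_lt_compat; lra).
  rewrite Rabs_mult, (Rabs_pos_eq (/ (INR p + 1))) by lra.
  unfold Rdiv. apply (Rmult_le_compat_r (/ (INR p + 1))) in He; lra.
Qed.

Lemma cont_reaction (p : nat) (m : R) : cont (reaction p m).
Proof.
  apply cont_mult; [|apply cont_const].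
  apply (cont_comp (fun f => (1 - m) * f) exp); [|apply cont_exp].
  apply cont_mult; [apply cont_const | apply cont_id].
Qed.

(** Projection of h to the interval from 0 to c / max(r, r1).  The bound c/r is
    the one expected of the solution; cutting it off at r1 makes the truncated
    slope bounded near 0, hence f bounded on bounded intervals. *)
Definition clamp (c r1 r h : R) : R := Rmax 0 (Rmin h (c / Rmax r r1)).

Lemma clamp_bounds (c r1 r h : R) :
  0 < c -> 0 < r1 -> 0 <= clamp c r1 r h <= c / Rmax r r1.
Proof.
  intros Hc Hr. assert (0 < c / Rmax r r1).
  { apply Rdiv_lt_0_compat; [exact Hc|]. assert (H := Rmax_r r r1). lra. }
  unfold clamp. split; [apply Rmax_l|]. apply Rmax_lub; [lra | apply Rmin_r].
Qed.

Lemma clamp_le_r1 (c r1 r h : R) : 0 < c -> 0 < r1 -> clamp c r1 r h <= c / r1.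
Proof.
  intros Hc Hr. eapply Rle_trans; [now apply clamp_bounds|].
  apply Rmult_le_compat_l; [lra|]. apply Rinv_le_contravar; [exact Hr | apply Rmax_r].
Qed.

Lemma clamp_mult_le (c r1 r h : R) :
  0 < c -> 0 < r1 -> 0 <= r -> 0 <= r * clamp c r1 r h <= c.
Proof.
  intros Hc Hr1 Hr. destruct (clamp_bounds c r1 r h Hc Hr1) as [H1 H2].
  split; [now apply Rmult_le_pos|].
  assert (Hm := Rmax_l r r1). assert (Hm' := Rmax_r r r1).
  assert (Hq : Rmax r r1 * (c / Rmax r r1) = c) by (field; lra).
  apply Rle_trans with (Rmax r r1 * (c / Rmax r r1)); [|lra].
  apply Rmult_le_compat; lra.
Qed.

Lemma clamp_lipschitz (c r1 r h1 h2 : R) :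
  Rabs (clamp c r1 r h1 - clamp c r1 r h2) <= Rabs (h1 - h2).
Proof.
  unfold clamp. generalize (c / Rmax r r1). intros M.
  apply Rle_trans with (Rabs (Rmin h1 M - Rmin h2 M)).
  - generalize (Rmin h1 M), (Rmin h2 M). intros u v.
    unfold Rmax, Rabs. destruct (Rle_dec 0 u), (Rle_dec 0 v);
      repeat destruct (Rcase_abs _); lra.
  - unfold Rmin, Rabs. destruct (Rle_dec h1 M), (Rle_dec h2 M);
      repeat destruct (Rcase_abs _); lra.
Qed.

Lemma clamp_eq (c r1 r h : R) : 0 <= h <= c / Rmax r r1 -> clamp c r1 r h = h.
Proof.
  intros [H1 H2]. unfold clamp. rewrite Rmin_left by exact H2. now apply Rmax_right.
Qed.

Lemma cont_clamp (c r1 : R) (h : R -> R) :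
  0 < r1 -> cont h -> cont (fun r => clamp c r1 r (h r)).
Proof.
  intros Hr Hh. apply cont_Rmax; [apply cont_const|]. apply cont_Rmin; [exact Hh|].
  apply cont_mult; [apply cont_const|].
  apply cont_inv.
  - apply cont_Rmax; [apply cont_id | apply cont_const].
  - intros x. assert (H := Rmax_r x r1). lra.
Qed.

(** The function f recovered from h = - s f' after truncation. *)
Definition trunc_f (s c r1 f0 : R) (h : R -> R) (r : R) : R :=
  f0 - s * RInt (fun x => clamp c r1 x (h x)) 0 r.

(** The right-hand side of h' + (n-1)/r h = s m h^2 + E(f) (a - beta r h), which
    is the equation for h = - s g when alpha = s a. *)
Definition trunc_H (p : nat) (m a be s c r1 f0 : R) (h : R -> R) (r : R) : R :=
  s * m * clamp c r1 r (h r) ^ 2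
  + reaction p m (trunc_f s c r1 f0 h r) * (a - be * r * clamp c r1 r (h r)).

Lemma is_derive_trunc_f (s c r1 f0 : R) (h : R -> R) (r : R) :
  0 < r1 -> cont h ->
  is_derive (trunc_f s c r1 f0 h) r (- s * clamp c r1 r (h r)).
Proof.
  intros Hr Hh.
  assert (Hd := is_derive_primitive _ r (cont_clamp c r1 h Hr Hh)). simpl in Hd.
  unfold trunc_f. 
  apply (is_derive_ext (fun r => plus f0 (scal (- s) (RInt (fun x => clamp c r1 x (h x)) 0 r)))).
  { intros t. unfold plus, scal; simpl. unfold mult; simpl. ring. }
  replace (- s * clamp c r1 r (h r)) with (plus zero (scal (- s) (clamp c r1 r (h r)))).
  2:{ unfold plus, zero, scal; simpl. unfold mult; simpl. ring. }
  apply (is_derive_plus (fun _ => f0)); [apply (is_derive_const f0 r)|].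
  apply (is_derive_scal (fun r => RInt (fun x => clamp c r1 x (h x)) 0 r) r (- s)), Hd.
Qed.

Lemma cont_trunc_H (p : nat) (m a be s c r1 f0 : R) (h : R -> R) :
  0 < r1 -> cont h -> cont (trunc_H p m a be s c r1 f0 h).
Proof.
  intros Hr Hh. assert (Hcl := cont_clamp c r1 h Hr Hh). apply cont_plus.
  - apply (cont_mult (fun _ => s * m)); [apply cont_const|].
    apply (cont_comp (fun r => clamp c r1 r (h r)) (fun y => y ^ 2) Hcl), cont_pow.
  - apply cont_mult.
    + apply (cont_comp (trunc_f s c r1 f0 h) (reaction p m)); [|apply cont_reaction].
      intros x. eapply is_derive_continuous. now apply is_derive_trunc_f.
    + apply cont_minus; [apply cont_const|]. apply cont_mult; [|exact Hcl].
      apply cont_mult; [apply cont_const | apply cont_id].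
Qed.

Lemma trunc_f_near (s c r1 f0 : R) (h : R -> R) (r : R) :
  s = 1 \/ s = -1 -> 0 < c -> 0 < r1 -> cont h -> 0 <= r ->
  Rabs (trunc_f s c r1 f0 h r - f0) <= r * (c / r1).
Proof.
  intros Hs Hc Hr1 Hh Hr. unfold trunc_f.
  replace (f0 - s * RInt (fun x => clamp c r1 x (h x)) 0 r - f0)
    with (- (s * RInt (fun x => clamp c r1 x (h x)) 0 r)) by ring.
  rewrite Rabs_Ropp, Rabs_mult, (sign_Rabs s Hs), Rmult_1_l.
  replace (r * (c / r1)) with ((r - 0) * (c / r1)) by ring.
  apply abs_RInt_le_const; [exact Hr | now apply cont_ex_RInt, cont_clamp|].
  intros t _. destruct (clamp_bounds c r1 t (h t) Hc Hr1).
  rewrite Rabs_pos_eq by assumption. now apply clamp_le_r1.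
Qed.

Lemma trunc_f_diff (s c r1 f0 : R) (h1 h2 : R -> R) (r : R) :
  s = 1 \/ s = -1 -> 0 < r1 -> cont h1 -> cont h2 -> 0 <= r ->
  Rabs (trunc_f s c r1 f0 h1 r - trunc_f s c r1 f0 h2 r)
    <= RInt (fun x => Rabs (h1 x - h2 x)) 0 r.
Proof.
  intros Hs Hr1 C1 C2 Hr. unfold trunc_f.
  assert (E1 := cont_clamp c r1 h1 Hr1 C1). assert (E2 := cont_clamp c r1 h2 Hr1 C2).
  assert (Hm := RInt_minus (V := R_CompleteNormedModule) _ _ 0 r
                  (cont_ex_RInt _ 0 r E1) (cont_ex_RInt _ 0 r E2)).
  unfold minus, plus, opp in Hm; simpl in Hm.
  match goal with |- Rabs ?X <= _ => replace X with
    (- s * RInt (fun x => clamp c r1 x (h1 x) + - clamp c r1 x (h2 x)) 0 r) end.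
  2:{ rewrite Hm. ring. }
  rewrite Rabs_mult, Rabs_Ropp, (sign_Rabs s Hs), Rmult_1_l.
  assert (E3 : cont (fun x => clamp c r1 x (h1 x) + - clamp c r1 x (h2 x))) by
    (now apply cont_minus).
  eapply Rle_trans; [apply abs_RInt_le; [exact Hr | now apply cont_ex_RInt]|].
  apply RInt_le; [exact Hr | | |].
  - now apply cont_ex_RInt, cont_abs.
  - now apply cont_ex_RInt, cont_abs, cont_minus.
  - intros x _. apply clamp_lipschitz.
Qed.

(** The dependence on h is local through the truncated slope and nonlocal
    through f; the latter is what the integral on the right accounts for. *)
Lemma trunc_H_diff (p : nat) (m a be s c r1 f0 b : R) :
  0 < m -> 0 < a -> 0 < be -> s = 1 \/ s = -1 -> be * c = a -> 0 < r1 -> 0 <= b ->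
  exists A B, 0 <= A /\ 0 <= B /\
    forall h1 h2, cont h1 -> cont h2 -> forall r, 0 <= r <= b ->
      Rabs (trunc_H p m a be s c r1 f0 h1 r - trunc_H p m a be s c r1 f0 h2 r)
      <= A * Rabs (h1 r - h2 r) + B * RInt (fun x => Rabs (h1 x - h2 x)) 0 r.
Proof.
  intros Hm Ha Hbe Hs Hca Hr1 Hb.
  assert (Hc : 0 < c) by nra.
  set (K := c / r1). assert (HK : 0 < K) by (now apply Rdiv_lt_0_compat).
  set (Eb := exp ((1 - m) * f0 + Rabs (1 - m) * (b * K)) / (INR p + 1)).
  assert (HEb : 0 < Eb).
  { apply Rdiv_lt_0_compat; [apply exp_pos|]. assert (H := pos_INR p). lra. }
  assert (Habs := Rabs_pos (1 - m)).
  exists (2 * m * K + Eb * be * b), (Eb * Rabs (1 - m) * a).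
  split; [|split].
  { assert (0 <= Eb * be * b) by (apply Rmult3_le_pos; lra). nra. }
  { apply Rmult3_le_pos; lra. }
  intros h1 h2 C1 C2 r Hr. unfold trunc_H.
  set (k1 := clamp c r1 r (h1 r)). set (k2 := clamp c r1 r (h2 r)).
  set (f1 := trunc_f s c r1 f0 h1 r). set (f2 := trunc_f s c r1 f0 h2 r).
  assert (Hk : Rabs (k1 - k2) <= Rabs (h1 r - h2 r)) by apply clamp_lipschitz.
  assert (Hk1 : 0 <= k1 <= K).
  { split; [now apply clamp_bounds | now apply clamp_le_r1]. }
  assert (Hk2 : 0 <= k2 <= K).
  { split; [now apply clamp_bounds | now apply clamp_le_r1]. }
  assert (Hq1 := clamp_mult_le c r1 r (h1 r) Hc Hr1 (proj1 Hr)). fold k1 in Hq1.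
  assert (Hf : Rabs (f1 - f2) <= RInt (fun x => Rabs (h1 x - h2 x)) 0 r)
    by (apply trunc_f_diff; tauto).
  assert (HrK : r * K <= b * K) by (apply Rmult_le_compat_r; lra).
  assert (Hn1 : Rabs (f1 - f0) <= b * K).
  { eapply Rle_trans; [apply trunc_f_near; tauto | exact HrK]. }
  assert (Hn2 : Rabs (f2 - f0) <= b * K).
  { eapply Rle_trans; [apply trunc_f_near; tauto | exact HrK]. }
  assert (HE := reaction_lipschitz p m f0 f1 f2 _ Hn1 Hn2). fold Eb in HE.
  assert (HE2 := reaction_le p m f0 f2 _ Hn2). fold Eb in HE2.
  assert (HE2' := reaction_pos p m f2).
  set (E1 := reaction p m f1) in *. set (E2 := reaction p m f2) in *.
  replace (s * m * k1 ^ 2 + E1 * (a - be * r * k1) - (s * m * k2 ^ 2 + E2 * (a - be * r * k2)))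
    with (s * (m * (k1 + k2)) * (k1 - k2) + (E1 - E2) * (a - be * (r * k1))
          + - (E2 * be * r) * (k1 - k2)) by ring.
  assert (T1 : Rabs (s * (m * (k1 + k2)) * (k1 - k2)) <= 2 * m * K * Rabs (h1 r - h2 r)).
  { rewrite Rabs_mult, Rabs_mult, (sign_Rabs s Hs), Rmult_1_l.
    assert (Hmk : 0 <= m * (k1 + k2)) by (apply Rmult_le_pos; lra).
    rewrite (Rabs_pos_eq (m * (k1 + k2))) by exact Hmk.
    apply Rmult_le_compat; [exact Hmk | apply Rabs_pos | nra | exact Hk]. }
  assert (T2 : Rabs ((E1 - E2) * (a - be * (r * k1))) <=
               Eb * Rabs (1 - m) * a * RInt (fun x => Rabs (h1 x - h2 x)) 0 r).
  { rewrite Rabs_mult.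
    assert (Hg : 0 <= a - be * (r * k1) <= a).
    { rewrite <- Hca. split; nra. }
    rewrite (Rabs_pos_eq (a - _)) by lra.
    apply Rle_trans with (Eb * Rabs (1 - m) * Rabs (f1 - f2) * a).
    - apply Rmult_le_compat; [apply Rabs_pos | lra | exact HE | lra].
    - apply Rle_trans with (Eb * Rabs (1 - m) * a * Rabs (f1 - f2)); [lra|].
      apply Rmult_le_compat_l; [|exact Hf]. apply Rmult3_le_pos; lra. }
  assert (T3 : Rabs (- (E2 * be * r) * (k1 - k2)) <= Eb * be * b * Rabs (h1 r - h2 r)).
  { rewrite Rabs_mult, Rabs_Ropp.
    assert (He : 0 <= E2 * be * r) by (apply Rmult3_le_pos; lra).
    rewrite (Rabs_pos_eq (E2 * be * r)) by exact He.
    apply Rmult_le_compat; [exact He | apply Rabs_pos | | exact Hk].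
    apply Rmult_le_compat; [apply Rmult_le_pos; lra | lra | | lra].
    apply Rmult_le_compat_r; lra. }
  eapply Rle_trans; [apply Rabs_triang|].
  assert (T12 := Rabs_triang (s * (m * (k1 + k2)) * (k1 - k2)) ((E1 - E2) * (a - be * (r * k1)))).
  lra.
Qed.

Lemma trunc_fixed_point (p : nat) (m a be s c r1 f0 : R) :
  0 < m -> 0 < a -> 0 < be -> s = 1 \/ s = -1 -> be * c = a -> 0 < r1 ->
  exists h, cont h /\
    forall r, 0 <= r -> damped (S p) (trunc_H p m a be s c r1 f0 h) r = h r.
Proof.
  intros Hm Ha Hbe Hs Hca Hr1.
  apply (volterra_fixed_point (fun h => damped (S p) (trunc_H p m a be s c r1 f0 h))).
  { intros h Hh. now apply cont_damped, cont_trunc_H. }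
  intros b Hb.
  destruct (trunc_H_diff p m a be s c r1 f0 b Hm Ha Hbe Hs Hca Hr1 Hb)
    as [A [B [HA [HB HAB]]]].
  exists (A + B * b). split; [assert (0 <= B * b) by (now apply Rmult_le_pos); lra|].
  intros h1 h2 C1 C2 r Hr.
  assert (D1 := cont_trunc_H p m a be s c r1 f0 h1 Hr1 C1).
  assert (D2 := cont_trunc_H p m a be s c r1 f0 h2 Hr1 C2).
  rewrite damped_minus by assumption.
  eapply Rle_trans; [apply damped_bound; [now apply cont_minus | lra]|].
  set (d := fun x => Rabs (h1 x - h2 x)).
  assert (Cd : cont d) by (now apply cont_abs, cont_minus).
  assert (Hpos : forall u v, u <= v -> 0 <= RInt d u v).
  { intros u v Huv. apply RInt_ge_0; [exact Huv | now apply cont_ex_RInt|].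
    intros x _. apply Rabs_pos. }
  set (I := RInt d 0 r). assert (HI : 0 <= I) by (apply Hpos; lra).
  apply Rle_trans with (RInt (fun x => A * d x + B * I) 0 r).
  - apply RInt_le; [lra | | |].
    + now apply cont_ex_RInt, cont_abs, cont_minus.
    + apply cont_ex_RInt, cont_plus; [|apply cont_const].
      apply cont_mult; [apply cont_const | exact Cd].
    + intros x Hx. eapply Rle_trans; [apply HAB; auto; lra|].
      apply Rplus_le_compat_l, Rmult_le_compat_l; [exact HB|].
      change (RInt d 0 x <= RInt d 0 r).
      assert (Hch := RInt_Chasles (V := R_CompleteNormedModule) d 0 x r
                (cont_ex_RInt d 0 x Cd) (cont_ex_RInt d x r Cd)).
      unfold plus in Hch; simpl in Hch. assert (H := Hpos x r ltac:(lra)). lra.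
  - rewrite (RInt_plus (V := R_CompleteNormedModule) (fun x => A * d x) (fun _ => B * I)).
    2:{ apply cont_ex_RInt, cont_mult; [apply cont_const | exact Cd]. }
    2:{ apply cont_ex_RInt, cont_const. }
    rewrite RInt_Rmult by exact Cd. fold I.
    rewrite RInt_const. unfold plus, scal; simpl. unfold mult; simpl.
    assert (0 <= B * I) by (now apply Rmult_le_pos). nra.
Qed.

(** * A priori bounds *)

(** The truncation is not active on the fixed point.  In terms of
    F = r^(n-1) h, whose derivative is r^(n-1) H without any singular term, the
    barriers are F = 0, F = Y r^n with Y = c / r1^2 on [0, r1], and F = c r^(n-2)
    on [r1, oo).

    On [0, r1] one has |f - f0| <= c, so E(f) is at most the constant in the
    hypothesis on r1, which says that E(f) a <= 2 Y.  Since moreover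
    s m k^2 <= (n-2) Y for every k <= c / r1, it follows that H <= n Y, which is
    the derivative of Y r^n divided by r^(n-1).  The two barriers meet at r1,
    where both say that h <= c / r1. *)
Lemma trunc_slope_bounds (p : nat) (m a be s c r1 f0 : R) (h : R -> R) :
  0 < m -> 0 < a -> 0 < be -> s = 1 \/ s = -1 -> be * c = a -> 0 < r1 ->
  s * m * c <= INR p ->
  r1 ^ 2 * (exp ((1 - m) * f0 + Rabs (1 - m) * c) / (INR p + 1) * be) = 2 ->
  cont h ->
  (forall r, 0 <= r -> damped (S p) (trunc_H p m a be s c r1 f0 h) r = h r) ->
  forall r, 0 <= r -> 0 <= h r <= c / Rmax r r1.
Proof.
  intros Hm Ha Hbe Hs Hca Hr1 Hsmc HE0 Hh Hfix.
  assert (Hc : 0 < c) by nra.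
  set (H := trunc_H p m a be s c r1 f0 h) in *.
  assert (HH : cont H) by now apply cont_trunc_H.
  assert (HpI := pos_INR p).
  set (F := fun r => RInt (fun x => x ^ S p * H x) 0 r).
  assert (HF : forall r, 0 <= r -> F r = r ^ S p * h r).
  { intros r Hr. unfold F. rewrite <- damped_mult by exact Hr. now rewrite Hfix. }
  assert (HF' : forall r, is_derive F r (r ^ S p * H r)).
  { intros r. apply (is_derive_primitive (fun x => x ^ S p * H x)).
    now apply cont_damped_integrand. }
  assert (HFc : forall r, continuous F r) by (intros r; eapply is_derive_continuous, HF').
  assert (HF0 : F 0 = 0) by (rewrite HF by lra; simpl; ring).
  assert (Hpw : forall r k, 0 < r -> 0 < r ^ k) by (intros; now apply pow_lt).
  (* Only here does s m c <= n - 2 enter; for s = -1 the left side is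
     nonpositive. *)
  assert (Hquad : forall y M, 0 <= y <= c * M -> 0 < M -> s * m * y ^ 2 <= INR p * (c * M * M)).
  { intros y M Hy HM. destruct Hs as [-> | ->].
    - assert (y ^ 2 <= (c * M) ^ 2) by (apply pow_incr; lra).
      assert (1 * m * (c * M) ^ 2 <= INR p * (c * M * M)).
      { replace (1 * m * (c * M) ^ 2) with ((1 * m * c) * (c * M * M)) by ring.
        apply Rmult_le_compat_r; [|exact Hsmc].
        apply Rmult_le_pos; [apply Rmult_le_pos|]; lra. }
      nra.
    - assert (0 <= m * y ^ 2) by (apply Rmult_le_pos; [lra | apply pow2_ge_0]).
      assert (0 <= INR p * (c * M * M)) by
        (apply Rmult_le_pos; [lra|]; apply Rmult_le_pos; [apply Rmult_le_pos|]; lra).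
      lra. }
  assert (Hlow : forall r, 0 <= r -> 0 <= h r).
  { intros r Hr. destruct (Req_dec r 0) as [-> | Hr0].
    { rewrite <- Hfix by lra. unfold damped. rewrite Rmax_left by lra.
      rewrite RInt_point. unfold zero; simpl. unfold Rdiv. lra. }
    assert (Hb : - 1 * F r <= 0).
    { apply (barrier (fun x => - 1 * F x) (fun x => - 1 * (x ^ S p * H x)) 0 r Hr).
      - intros x _. apply (continuous_mult (fun _ => -1)); [apply continuous_const | apply HFc].
      - intros x _. now apply is_derive_cmult.
      - intros x Hx Hpos. rewrite HF in Hpos by lra.
        assert (Hhx : h x <= 0).
        { apply Rnot_lt_le. intros Hlt. assert (H1 := Hpw x (S p) ltac:(lra)).
          assert (0 < x ^ S p * h x) by (now apply Rmult_lt_0_compat). lra. }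
        assert (Hcl : clamp c r1 x (h x) = 0).
        { unfold clamp. apply Rmax_left. eapply Rle_trans; [apply Rmin_l | exact Hhx]. }
        assert (HHx : 0 <= H x).
        { unfold H, trunc_H. rewrite Hcl.
          assert (H1 := reaction_pos p m (trunc_f s c r1 f0 h x)).
          assert (0 < reaction p m (trunc_f s c r1 f0 h x) * a) by (now apply Rmult_lt_0_compat).
          simpl. nra. }
        assert (H1 := Hpw x (S p) ltac:(lra)). nra.
      - rewrite HF0. lra. }
    rewrite HF in Hb by exact Hr. assert (H1 := Hpw r (S p) ltac:(lra)). nra. }
  set (Y := c * / r1 * / r1).
  assert (HY : 0 < Y).
  { assert (0 < / r1) by (now apply Rinv_0_lt_compat). unfold Y.
    apply Rmult_lt_0_compat; [apply Rmult_lt_0_compat|]; lra. }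
  assert (Hin : forall r, 0 < r <= r1 -> h r <= Y * r).
  { intros r Hr.
    assert (Hd : F r - Y * r ^ S (S p) <= F 0 - Y * 0 ^ S (S p)).
    { apply (derive_le0_decr (fun x => F x - Y * x ^ S (S p))
        (fun x => x ^ S p * H x - Y * ((INR (S p) + 1) * x ^ S p))); [lra | |].
      - intros x _. apply (continuous_minus F); [apply HFc|].
        apply (cont_mult (fun _ => Y)); [apply cont_const | apply cont_pow].
      - intros x Hx. split.
        + apply is_derive_sub; [apply HF' | apply is_derive_cmult, is_derive_power].
        + assert (HHx : H x <= Y * (INR (S p) + 1)).
          { unfold H, trunc_H.
            destruct (clamp_bounds c r1 x (h x) Hc Hr1) as [Hk0 _].
            assert (Hk1 := clamp_le_r1 c r1 x (h x) Hc Hr1).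
            destruct (clamp_mult_le c r1 x (h x) Hc Hr1 ltac:(lra)) as [Hq0 _].
            assert (Q := Hquad _ (/ r1) (conj Hk0 Hk1) (Rinv_0_lt_compat _ Hr1)).
            fold Y in Q.
            assert (Hnear : Rabs (trunc_f s c r1 f0 h x - f0) <= c).
            { eapply Rle_trans; [apply trunc_f_near; auto; lra|].
              apply Rle_trans with (r1 * (c / r1)); [|right; field; lra].
              apply Rmult_le_compat_r; [|lra]. left. now apply Rdiv_lt_0_compat. }
            assert (HE := reaction_le p m f0 _ c Hnear).
            assert (HEp := reaction_pos p m (trunc_f s c r1 f0 h x)).
            set (E := reaction p m (trunc_f s c r1 f0 h x)) in *.
            set (E0 := exp ((1 - m) * f0 + Rabs (1 - m) * c) / (INR p + 1)) in *.
            assert (HEa : E0 * a = 2 * Y).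
            { unfold Y. rewrite <- HE0, <- Hca. field. lra. }
            set (k := clamp c r1 x (h x)) in *.
            assert (0 <= E * (be * (x * k))).
            { apply Rmult_le_pos; [lra|]. apply Rmult_le_pos; lra. }
            assert (E * a <= E0 * a) by (apply Rmult_le_compat_r; lra).
            rewrite S_INR. nra. }
          assert (H1 := Hpw x (S p) ltac:(lra)). nra. }
    rewrite HF0, HF in Hd by lra.
    replace (0 ^ S (S p)) with 0 in Hd by (simpl; ring).
    change (r ^ S (S p)) with (r * r ^ S p) in Hd.
    assert (H1 := Hpw r (S p) ltac:(lra)).
    apply (Rmult_le_reg_l (r ^ S p)); [exact H1 | lra]. }
  assert (Hout : forall r, r1 <= r -> r * h r <= c).
  { intros r Hr.
    assert (Hb : F r - c * r ^ p <= 0).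
    { apply (barrier (fun x => F x - c * x ^ p)
        (fun x => x ^ S p * H x - c * (INR p * / x * x ^ p)) r1 r Hr).
      - intros x _. apply (continuous_minus F); [apply HFc|].
        apply (cont_mult (fun _ => c)); [apply cont_const | apply cont_pow].
      - intros x Hx. apply is_derive_sub; [apply HF' | apply is_derive_cmult].
        destruct p as [|q].
        + simpl. replace (0 * / x * 1) with 0 by ring. apply (is_derive_const (V := R_NormedModule)).
        + replace (INR (S q) * / x * x ^ S q) with ((INR q + 1) * x ^ q);
            [apply is_derive_power|]. rewrite S_INR. simpl. field. lra.
      - intros x Hx Hpos. rewrite HF in Hpos by lra.
        assert (H1 := Hpw x p ltac:(lra)).
        change (x ^ S p) with (x * x ^ p) in Hpos |- *.
        assert (Hxh : c < x * h x) by (apply (Rmult_lt_reg_r (x ^ p)); lra).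
        assert (Hix : 0 < / x) by (apply Rinv_0_lt_compat; lra).
        assert (Hcl : clamp c r1 x (h x) = c * / x).
        { unfold clamp. rewrite (Rmax_left x r1) by lra. rewrite Rmin_right.
          - apply Rmax_right. left. apply Rmult_lt_0_compat; lra.
          - apply (Rmult_le_reg_l x); [lra|].
            replace (x * (c / x)) with c by (field; lra). lra. }
        assert (HHx : H x <= INR p * (c * / x * / x)).
        { unfold H, trunc_H. rewrite Hcl.
          replace (a - be * x * (c * / x)) with 0 by (rewrite <- Hca; field; lra).
          assert (Q := Hquad (c * / x) (/ x)). 
          assert (0 <= c * / x) by (apply Rmult_le_pos; lra). lra. }
        replace (c * (INR p * / x * x ^ p)) with
          (x * x ^ p * (INR p * (c * / x * / x))) by (field; lra).
        assert (0 <= x * x ^ p) by (apply Rmult_le_pos; lra).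
        nra.
      - rewrite HF by lra. assert (H1 := Hin r1 ltac:(lra)).
        change (r1 ^ S p) with (r1 * r1 ^ p). assert (H2 := Hpw r1 p Hr1).
        assert (r1 * h r1 <= c).
        { replace c with (r1 * (Y * r1)) by (unfold Y; field; lra).
          apply Rmult_le_compat_l; lra. }
        nra. }
    rewrite HF in Hb by lra. change (r ^ S p) with (r * r ^ p) in Hb.
    apply (Rmult_le_reg_r (r ^ p)); [apply Hpw; lra | lra]. }
  intros r Hr. split; [now apply Hlow|].
  destruct (Rle_dec r r1) as [Hle | Hgt].
  - rewrite Rmax_right by exact Hle. destruct (Req_dec r 0) as [-> | Hr0].
    { rewrite <- Hfix by lra. unfold damped. rewrite Rmax_left by lra.
      rewrite RInt_point. unfold zero; simpl. unfold Rdiv at 1. rewrite Rmult_0_l.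
      left. now apply Rdiv_lt_0_compat. }
    eapply Rle_trans; [apply Hin; lra|].
    apply Rle_trans with (Y * r1); [apply Rmult_le_compat_l; lra|].
    right. unfold Y. field. lra.
  - rewrite Rmax_left by lra. apply (Rmult_le_reg_l r); [lra|].
    replace (r * (c / r)) with c by (field; lra). apply Hout. lra.
Qed.

(** * Solutions in logarithmic variables *)

(** The system for f = ln v and g = f', with n = p + 2.  Continuity is imposed on
    the whole line, where only the values at r >= 0 matter, to keep one-sided
    notions out of the analysis. *)
Definition log_profile (p : nat) (m al be f0 : R) (f g : R -> R) : Prop :=
  cont f /\ cont g /\ f 0 = f0 /\ g 0 = 0 /\
  forall r, 0 < r ->
    is_derive f r (g r) /\
    is_derive g r (- (INR p + 1) / r * g r - m * g r ^ 2
                   - reaction p m (f r) * (al + be * r * g r)).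

(** The difference P = c - r h satisfies
    P' = h (n - 2 - s m r h) - E(f) beta r P >= - E(f) beta r P, because
    s m r h <= n - 2 by the bounds on r h and s m c.  Gronwall's inequality and
    P(0) = c > 0 keep P positive, also in the borderline case s m c = n - 2, in
    which r h = c would be an invariant curve. *)
Lemma weighted_slope_lt (p : nat) (m a be s c : R) (f h : R -> R) :
  0 < m -> 0 < be -> 0 < c -> s * m * c <= INR p -> be * c = a ->
  s = 1 \/ s = -1 ->
  cont f -> cont h ->
  (forall r, 0 < r -> 0 <= h r /\ r * h r <= c) ->
  (forall r, 0 < r -> is_derive h r
     (s * m * h r ^ 2 + reaction p m (f r) * (a - be * r * h r) - (INR p + 1) / r * h r)) ->
  forall r, 0 < r -> r * h r < c.
Proof.
  intros Hm Hbe Hc Hsmc Hca Hs Hf Hh Hb Hd r Hr.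
  destruct (cont_bounded (fun x => reaction p m (f x)) r) as [M [HM HMb]]; [lra | |].
  { apply (cont_comp f (reaction p m) Hf), cont_reaction. }
  assert (Hg : r * h r - c <= (0 * h 0 - c) * exp (- (r * M * be) * (r - 0))).
  { apply (gronwall (fun x => x * h x - c) (fun x => 1 * h x + x *
      (s * m * h x ^ 2 + reaction p m (f x) * (a - be * x * h x) - (INR p + 1) / x * h x) - 0));
      [lra | |].
    - intros x _. apply (cont_minus (fun x => x * h x) (fun _ => c)); [|apply cont_const].
      apply cont_mult; [apply cont_id | exact Hh].
    - intros x Hx. split.
      + apply is_derive_sub; [|apply (is_derive_const (V := R_NormedModule))].
        apply (is_derive_prod (fun t => t) h); [apply (is_derive_id (K := R_AbsRing)) | apply Hd; lra].
      + destruct (Hb x ltac:(lra)) as [H1 H2].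
        assert (HE := reaction_pos p m (f x)).
        specialize (HMb x ltac:(lra)). rewrite Rabs_pos_eq in HMb by lra.
        set (E := reaction p m (f x)) in *.
        replace (1 * h x + x * (s * m * h x ^ 2 + E * (a - be * x * h x)
                   - (INR p + 1) / x * h x) - 0)
          with (x * E * be * (c - x * h x) - h x * (INR p - s * m * (x * h x)))
          by (rewrite <- Hca; field; lra).
        assert (Hfr : 0 <= INR p - s * m * (x * h x)).
        { destruct Hs as [-> | ->].
          - assert (m * (x * h x) <= m * c) by (apply Rmult_le_compat_l; lra). lra.
          - assert (Hp := pos_INR p).
            assert (0 <= m * (x * h x)) by (repeat apply Rmult_le_pos; lra). lra. }
        assert (0 <= h x * (INR p - s * m * (x * h x))) by (now apply Rmult_le_pos).
        assert (HxE : x * E <= r * M) by (apply Rmult_le_compat; lra).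
        assert (x * E * be <= r * M * be) by (apply Rmult_le_compat_r; lra).
        assert (x * E * be * (c - x * h x) <= r * M * be * (c - x * h x))
          by (apply Rmult_le_compat_r; lra).
        lra. }
  assert (He := exp_pos (- (r * M * be) * (r - 0))). nra.
Qed.

(** The derivative of f exists on the whole line, which yields the one-sided
    derivative of exp f at 0.  The last conclusion is the monotonicity of w1 in
    logarithmic form, since alpha = s a. *)
Lemma log_profile_exists (p : nat) (m a be s f0 : R) :
  0 < m -> 0 < a -> 0 < be -> s = 1 \/ s = -1 -> s * m * (a / be) <= INR p ->
  exists f g, log_profile p m (s * a) be f0 f g /\
    (forall r, is_derive f r (g r)) /\
    (forall r, 0 < r -> 0 < a + s * be * r * g r).
Proof.
  intros Hm Ha Hbe Hs Hsmc.
  set (c := a / be) in *.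
  assert (Hc : 0 < c) by (now apply Rdiv_lt_0_compat).
  assert (Hca : be * c = a) by (unfold c; field; lra).
  clearbody c.
  set (Q := exp ((1 - m) * f0 + Rabs (1 - m) * c) / (INR p + 1) * be).
  assert (HQ : 0 < Q).
  { assert (HpI := pos_INR p). apply Rmult_lt_0_compat; [|exact Hbe].
    apply Rdiv_lt_0_compat; [apply exp_pos | lra]. }
  (* r1 makes the reaction at most twice the slope of the inner barrier. *)
  set (r1 := sqrt (2 / Q)).
  assert (H2Q : 0 < 2 / Q) by (apply Rdiv_lt_0_compat; lra).
  assert (Hr1 : 0 < r1) by (now apply sqrt_lt_R0).
  assert (Hr1Q : r1 ^ 2 * Q = 2).
  { unfold r1. rewrite pow2_sqrt by lra. field. lra. }
  clearbody r1.
  destruct (trunc_fixed_point p m a be s c r1 f0 Hm Ha Hbe Hs Hca Hr1) as [h [Hh Hfix]].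
  assert (Hbd := trunc_slope_bounds p m a be s c r1 f0 h Hm Ha Hbe Hs Hca Hr1 Hsmc Hr1Q Hh Hfix).
  set (f := trunc_f s c r1 f0 h).
  set (k := fun r => clamp c r1 r (h r)).
  assert (Hk : forall r, 0 <= r -> k r = h r).
  { intros r Hr. apply clamp_eq, Hbd, Hr. }
  assert (Hkc : cont k) by now apply cont_clamp.
  assert (Hfd : forall r, is_derive f r (- s * k r)) by (intros r; now apply is_derive_trunc_f).
  assert (Hfc : cont f) by (intros r; eapply is_derive_continuous, Hfd).
  assert (Hpos : forall r, 0 < r -> locally r (fun t => 0 < t)) by (intros r Hr; now apply open_gt).
  assert (Hhd : forall r, 0 < r -> is_derive h r
     (s * m * h r ^ 2 + reaction p m (f r) * (a - be * r * h r) - (INR p + 1) / r * h r)).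
  { intros r Hr.
    apply (is_derive_ext_loc (damped (S p) (trunc_H p m a be s c r1 f0 h))).
    - generalize (Hpos r Hr). apply filter_imp. intros t Ht. apply Hfix. lra.
    - assert (Hd := is_derive_damped (S p) _ r (cont_trunc_H p m a be s c r1 f0 h Hr1 Hh) Hr).
      rewrite Hfix, S_INR in Hd by lra. unfold trunc_H in Hd at 2.
      fold (k r) in Hd. rewrite Hk in Hd by lra. exact Hd. }
  assert (Hrc : forall r, 0 < r -> 0 <= h r /\ r * h r <= c).
  { intros r Hr. destruct (Hbd r ltac:(lra)) as [H1 H2]. split; [exact H1|].
    rewrite <- Hk by lra. apply clamp_mult_le; lra. }
  assert (Hstrict := weighted_slope_lt p m a be s c f h Hm Hbe Hc Hsmc Hca Hs Hfc Hh Hrc Hhd).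
  assert (Hss : s * s = 1) by (destruct Hs as [-> | ->]; ring).
  exists f, (fun r => - s * k r). split; [split; [|split; [|split; [|split]]] | split].
  - exact Hfc.
  - apply (cont_mult (fun _ => - s)); [apply cont_const | exact Hkc].
  - unfold f, trunc_f. rewrite RInt_point. unfold zero; simpl. ring.
  - rewrite Hk by lra. rewrite <- Hfix by lra. unfold damped. rewrite Rmax_left by lra.
    rewrite RInt_point. unfold zero; simpl. unfold Rdiv. ring.
  - intros r Hr. split; [apply Hfd|].
    apply (is_derive_ext_loc (fun t => - s * h t)).
    + generalize (Hpos r Hr). apply filter_imp. intros t Ht. rewrite Hk; [reflexivity | lra].
    + rewrite Hk by lra.
      replace (- (INR p + 1) / r * (- s * h r) - m * (- s * h r) ^ 2
               - reaction p m (f r) * (s * a + be * r * (- s * h r)))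
        with (- s * (s * m * h r ^ 2 + reaction p m (f r) * (a - be * r * h r)
                     - (INR p + 1) / r * h r)).
      * apply is_derive_cmult, Hhd, Hr.
      * replace (- m * (- s * h r) ^ 2) with (- m * (s * s) * h r ^ 2) by ring.
        replace (- s * (s * m * h r ^ 2 + reaction p m (f r) * (a - be * r * h r)
                     - (INR p + 1) / r * h r))
          with (- (s * s) * m * h r ^ 2 - s * (reaction p m (f r) * (a - be * r * h r)
                     - (INR p + 1) / r * h r)) by ring.
        field. lra.
  - exact Hfd.
  - intros r Hr. rewrite Hk by lra.
    replace (a + s * be * r * (- s * h r)) with (a - (s * s) * be * (r * h r)) by ring.
    rewrite Hss. specialize (Hstrict r Hr). nra.
Qed.

(** In the derivative of the energy, the damping (n-1)/r and the term
    E(f1) beta r both multiply - (g1 - g2)^2, so that the singular coefficient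
    never has to be bounded. *)
Lemma log_profile_unique (p : nat) (m al be f0 : R) (f1 g1 f2 g2 : R -> R) :
  log_profile p m al be f0 f1 g1 -> log_profile p m al be f0 f2 g2 -> 0 <= be ->
  forall r, 0 <= r -> f1 r = f2 r.
Proof.
  intros [Cf1 [Cg1 [F1 [G1 D1]]]] [Cf2 [Cg2 [F2 [G2 D2]]]] Hbe r Hr.
  destruct (cont_bounded (fun x => f1 x - f0) r Hr) as [A1 [HA1 B1]].
  { apply cont_minus; [exact Cf1 | apply cont_const]. }
  destruct (cont_bounded (fun x => f2 x - f0) r Hr) as [A2 [HA2 B2]].
  { apply cont_minus; [exact Cf2 | apply cont_const]. }
  destruct (cont_bounded (fun x => m * (g1 x + g2 x)) r Hr) as [M [HM HMb]].
  { apply cont_mult; [apply cont_const | now apply cont_plus]. }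
  destruct (cont_bounded (fun x => al + be * x * g2 x) r Hr) as [N [HN HNb]].
  { apply cont_plus; [apply cont_const|]. apply cont_mult; [|exact Cg2].
    apply cont_mult; [apply cont_const | apply cont_id]. }
  set (A := A1 + A2).
  set (L := exp ((1 - m) * f0 + Rabs (1 - m) * A) / (INR p + 1) * Rabs (1 - m)).
  set (D := fun x => (f1 x - f2 x) * (f1 x - f2 x) + (g1 x - g2 x) * (g1 x - g2 x)).
  assert (HD : D r <= D 0 * exp ((1 + 2 * M + L * N) * (r - 0))).
  { assert (Cf : cont (fun x => f1 x - f2 x)) by now apply cont_minus.
    assert (Cg : cont (fun x => g1 x - g2 x)) by now apply cont_minus.
    set (w := fun x => (- (INR p + 1) / x * g1 x - m * g1 x ^ 2
                        - reaction p m (f1 x) * (al + be * x * g1 x))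
                     - (- (INR p + 1) / x * g2 x - m * g2 x ^ 2
                        - reaction p m (f2 x) * (al + be * x * g2 x))).
    apply (gronwall D (fun x =>
      ((g1 x - g2 x) * (f1 x - f2 x) + (f1 x - f2 x) * (g1 x - g2 x))
      + (w x * (g1 x - g2 x) + (g1 x - g2 x) * w x))); [exact Hr | |].
    - intros x _. apply cont_plus; now apply cont_mult.
    - intros x Hx. destruct (D1 x ltac:(lra)) as [Df1 Dg1].
      destruct (D2 x ltac:(lra)) as [Df2 Dg2].
      assert (Df := is_derive_sub _ _ _ _ _ Df1 Df2).
      assert (Dg := is_derive_sub _ _ _ _ _ Dg1 Dg2).
      split.
      + apply (is_derive_plus (fun x => (f1 x - f2 x) * (f1 x - f2 x))
                              (fun x => (g1 x - g2 x) * (g1 x - g2 x))).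
        * exact (is_derive_prod _ _ x _ _ Df Df).
        * exact (is_derive_prod _ _ x _ _ Dg Dg).
      + assert (Hp := pos_INR p).
        assert (HE := reaction_lipschitz p m f0 (f1 x) (f2 x) A).
        specialize (B1 x ltac:(lra)). specialize (B2 x ltac:(lra)).
        specialize (HMb x ltac:(lra)). specialize (HNb x ltac:(lra)).
        specialize (HE ltac:(unfold A; lra) ltac:(unfold A; lra)). fold L in HE.
        assert (HL : 0 <= L).
        { apply Rmult_le_pos; [|apply Rabs_pos]. left.
          apply Rdiv_lt_0_compat; [apply exp_pos | lra]. }
        assert (HEp := reaction_pos p m (f1 x)).
        unfold D.
        set (u := f1 x - f2 x) in *. set (v := g1 x - g2 x) in *.
        set (dE := reaction p m (f1 x) - reaction p m (f2 x)) in *.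
        assert (Hw : w x * v = - ((INR p + 1) * / x) * (v * v)
                     - (m * (g1 x + g2 x)) * (v * v)
                     - (reaction p m (f1 x) * (be * x)) * (v * v)
                     - dE * (al + be * x * g2 x) * v).
        { unfold w, dE, v. field. lra. }
        assert (Hvv : 0 <= v * v) by apply Rle_0_sqr.
        assert (S1 : 0 <= ((INR p + 1) * / x) * (v * v)).
        { apply Rmult_le_pos; [|exact Hvv]. apply Rmult_le_pos; [lra|].
          left. apply Rinv_0_lt_compat. lra. }
        assert (S2 : - (m * (g1 x + g2 x)) * (v * v) <= M * (v * v)).
        { apply Rmult_le_compat_r; [exact Hvv|].
          apply Rabs_le_between in HMb. lra. }
        assert (S3 : 0 <= (reaction p m (f1 x) * (be * x)) * (v * v)).
        { apply Rmult_le_pos; [|exact Hvv]. apply Rmult_le_pos; [lra|].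
          apply Rmult_le_pos; lra. }
        assert (S4 : - (dE * (al + be * x * g2 x) * v) <= L * N * ((u * u + v * v) / 2)).
        { eapply Rle_trans; [apply Rle_abs|].
          rewrite Rabs_Ropp, !Rabs_mult.
          apply Rle_trans with (L * Rabs u * N * Rabs v).
          - apply Rmult_le_compat_r; [apply Rabs_pos|].
            apply Rmult_le_compat; try apply Rabs_pos; assumption.
          - replace (L * Rabs u * N * Rabs v) with (L * N * (Rabs u * Rabs v)) by ring.
            apply Rmult_le_compat_l; [now apply Rmult_le_pos|].
            assert (Hu := Rsqr_abs u). assert (Hv := Rsqr_abs v).
            unfold Rsqr in Hu, Hv.
            assert (H0 := Rle_0_sqr (Rabs u - Rabs v)). unfold Rsqr in H0. lra. }
        assert (Huu : 0 <= u * u) by apply Rle_0_sqr.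
        assert (Huv : 2 * (u * v) <= u * u + v * v).
        { assert (H0 := Rle_0_sqr (u - v)). unfold Rsqr in H0. lra. }
        assert (0 <= M * (u * u)) by (now apply Rmult_le_pos).
        rewrite (Rmult_comm v (w x)), Hw. lra. }
  assert (D0 : D 0 = 0) by (unfold D; rewrite F1, F2, G1, G2; ring).
  rewrite D0, Rmult_0_l in HD. unfold D in HD.
  assert (H1 := Rle_0_sqr (f1 r - f2 r)). assert (H2 := Rle_0_sqr (g1 r - g2 r)).
  unfold Rsqr in *. apply Rminus_diag_uniq. apply Rsqr_0_uniq. unfold Rsqr. lra.
Qed.

(** * One-sided derivatives on the half-line *)

Lemma within_half_line_proper (x : R) :
  0 <= x -> ProperFilter (within half_line (locally x)).
Proof.
  intros Hx. constructor; [|apply within_filter, locally_filter].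
  intros P HP. exists x. apply (locally_singleton x _ HP). exact Hx.
Qed.

Lemma within_half_line_lim (x : R) : is_filter_lim (within half_line (locally x)) x.
Proof. intros P. apply (filter_le_within half_line). Qed.

Lemma is_derive_is_derive_in (f : R -> R) (x l : R) :
  0 <= x -> is_derive f x l -> is_derive_in half_line f x l.
Proof.
  intros Hx Hf. 
  apply (@filterdiff_locally R_AbsRing R_NormedModule R_NormedModule
           _ (within_half_line_proper x Hx) f x).
  - apply within_half_line_lim.
  - exact Hf.
Qed.

Lemma is_derive_in_is_derive (f : R -> R) (x l : R) :
  0 < x -> is_derive_in half_line f x l -> is_derive f x l.
Proof.
  intros Hx [Hl Hd]. split; [exact Hl|]. intros y Hy eps.
  assert (y = x) as -> by (symmetry; apply (is_filter_lim_locally_unique x y Hy)).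
  specialize (Hd x (within_half_line_lim x) eps).
  unfold within in Hd.
  assert (Hpos : locally x (fun t => 0 < t)) by now apply open_gt.
  generalize (filter_and _ _ Hd Hpos). apply filter_imp.
  intros t [Ht Htp]. apply Ht. unfold half_line. lra.
Qed.

Lemma is_derive_in_0_unique (f : R -> R) (l1 l2 : R) :
  is_derive_in half_line f 0 l1 -> is_derive_in half_line f 0 l2 -> l1 = l2.
Proof.
  intros [_ H1] [_ H2]. apply Rminus_diag_uniq, Rabs_eq_0.
  apply Rle_antisym; [|apply Rabs_pos]. apply le_epsilon. intros eps He.
  assert (He2 : 0 < eps / 2) by lra.
  specialize (H1 0 (within_half_line_lim 0) (mkposreal _ He2)).
  specialize (H2 0 (within_half_line_lim 0) (mkposreal _ He2)).
  unfold within in H1, H2. destruct (filter_and _ _ H1 H2) as [d Hd].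
  assert (Hdp := cond_pos d).
  assert (Hb : ball 0 d (d / 2)).
  { change (Rabs (d / 2 - 0) < d). rewrite Rabs_pos_eq; lra. }
  destruct (Hd _ Hb) as [K1 K2].
  specialize (K1 ltac:(unfold half_line; lra)). specialize (K2 ltac:(unfold half_line; lra)).
  cbn in K1, K2.
  change (Rabs (f (d / 2) + - f 0 + - ((d / 2 + - 0) * l1)) <= eps / 2 * Rabs (d / 2 + - 0)) in K1.
  change (Rabs (f (d / 2) + - f 0 + - ((d / 2 + - 0) * l2)) <= eps / 2 * Rabs (d / 2 + - 0)) in K2.
  rewrite (Rabs_pos_eq (d / 2 + - 0)) in K1, K2 by lra.
  apply Rabs_le_between in K1. apply Rabs_le_between in K2.
  rewrite Rplus_0_l.
  apply Rabs_le. split; apply (Rmult_le_reg_l (d / 2)); lra.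
Qed.

Lemma cont_half_line_extension (f : R -> R) :
  (forall x, 0 <= x -> filterlim f (within half_line (locally x)) (locally (f x))) ->
  cont (fun x => f (Rmax 0 x)).
Proof.
  intros Hf x. unfold continuous.
  apply (filterlim_comp _ _ _ (fun x => Rmax 0 x) f _
           (within half_line (locally (Rmax 0 x)))).
  - intros P HP. unfold within in HP.
    assert (Hm : continuous (fun x => Rmax 0 x) x)
      by (apply cont_Rmax; [apply cont_const | apply cont_id]).
    specialize (Hm _ HP). unfold filtermap in Hm |- *. revert Hm. apply filter_imp. intros y Hy.
    apply Hy. apply Rmax_l.
  - apply Hf, Rmax_l.
Qed.

(** * The equation for v and the logarithmic system *)

(** All derivatives are those of u^M = exp (M f), with M = m and M = 1. *)
Lemma derivatives_of_exp_profile (u f g : R -> R) (m r g' : R) :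
  locally r (fun t => u t = exp (f t)) ->
  locally r (fun t => is_derive f t (g t)) ->
  is_derive g r g' ->
  locally r (fun t => Derive u t = g t * exp (f t)) /\
  ex_derive (Derive u) r /\
  Derive_n u 2 r = (g' + g r ^ 2) * exp (f r) /\
  Derive (fun s => Rpower (u s) m) r = m * g r * exp (m * f r) /\
  Derive_n (fun s => Rpower (u s) m) 2 r = m * (g' + m * g r ^ 2) * exp (m * f r).
Proof.
  intros Hu Hf Hg.
  assert (Hexp : forall M, 
            locally r (fun t => is_derive (fun s => Rpower (u s) M) t (M * g t * exp (M * f t)))).
  { intros M. generalize (filter_and _ _ (locally_locally _ _ Hu) Hf).
    apply filter_imp. intros t [Hut Hft].
    apply (is_derive_ext_loc (fun s => exp (M * f s))).
    - revert Hut. apply filter_imp. intros s Hs. unfold Rpower.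
      now rewrite Hs, ln_exp.
    - assert (H := is_derive_comp exp (fun s => M * f s) t _ _
                     (is_derive_exp (M * f t)) (is_derive_cmult f t M _ Hft)).
      exact H. }
  assert (Hexp2 : forall M,
            is_derive (fun t => M * g t * exp (M * f t)) r
              (M * (g' + M * g r ^ 2) * exp (M * f r))).
  { intros M. assert (Hfr := locally_singleton _ _ Hf).
    assert (He := is_derive_comp exp (fun s => M * f s) r _ _
                     (is_derive_exp (M * f r)) (is_derive_cmult f r M _ Hfr)).
    assert (H := is_derive_prod _ _ r _ _ (is_derive_cmult g r M _ Hg) He).
    replace (M * (g' + M * g r ^ 2) * exp (M * f r)) with
      (M * g' * exp (M * f r) + M * g r * (M * g r * exp (M * f r))) by ring.
    exact H. }
  assert (HDP : forall M, locally r (fun t =>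
            Derive (fun s => Rpower (u s) M) t = M * g t * exp (M * f t))).
  { intros M. generalize (Hexp M). apply filter_imp. intros t Ht. now apply is_derive_unique. }
  assert (HDP2 : forall M, is_derive (Derive (fun s => Rpower (u s) M)) r
                   (M * (g' + M * g r ^ 2) * exp (M * f r))).
  { intros M. eapply is_derive_ext_loc; [|apply Hexp2].
    generalize (HDP M). apply filter_imp. intros t Ht. symmetry. exact Ht. }
  (* The exponent M = 1 gives the derivatives of u itself. *)
  assert (Hu1 : locally r (fun t => u t = Rpower (u t) 1)).
  { revert Hu. apply filter_imp. intros t Ht. rewrite Rpower_1; [reflexivity|].
    rewrite Ht. apply exp_pos. }
  assert (HDu : locally r (fun t => Derive u t = Derive (fun s => Rpower (u s) 1) t)).
  { generalize (locally_locally _ _ Hu1). apply filter_imp. intros t Ht.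
    now apply Derive_ext_loc. }
  assert (HDu2 : is_derive (Derive u) r ((g' + g r ^ 2) * exp (f r))).
  { replace ((g' + g r ^ 2) * exp (f r)) with
      (1 * (g' + 1 * g r ^ 2) * exp (1 * f r)) by (rewrite !Rmult_1_l; reflexivity).
    apply (is_derive_ext_loc (Derive (fun s => Rpower (u s) 1))); [|apply HDP2].
    revert HDu. apply filter_imp. intros t Ht. symmetry. exact Ht. }
  split; [|split; [|split; [|split]]].
  - generalize (filter_and _ _ HDu (HDP 1)). apply filter_imp. intros t [H1 H2].
    rewrite H1, H2, !Rmult_1_l. reflexivity.
  - eexists. exact HDu2.
  - change (Derive_n u 2 r) with (Derive (Derive u) r). now apply is_derive_unique.
  - apply (locally_singleton _ _ (HDP m)).
  - change (Derive_n (fun s => Rpower (u s) m) 2 r)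
      with (Derive (Derive (fun s => Rpower (u s) m)) r).
    apply is_derive_unique, HDP2.
Qed.

(** The left-hand side is (n-1) exp (m f) times the defect of the equation for
    g'. *)
Lemma ode_log_form (p : nat) (m al be r f g g' : R) :
  0 < m -> 0 < r ->
  ((INR p + 1) / m * (m * (g' + m * g ^ 2) * exp (m * f)
      + (INR p + 1) / r * (m * g * exp (m * f)))
    + al * exp f + be * r * (g * exp f) = 0
   <-> g' = - (INR p + 1) / r * g - m * g ^ 2 - reaction p m f * (al + be * r * g)).
Proof.
  intros Hm Hr. assert (Hp := pos_INR p).
  assert (He : exp f = exp (m * f) * exp ((1 - m) * f)).
  { rewrite <- exp_plus. f_equal. ring. }
  assert (Hm0 := exp_pos (m * f)). unfold reaction. rewrite He.
  set (X := exp (m * f)) in *. set (Y := exp ((1 - m) * f)) in *.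
  assert (E : (INR p + 1) / m * (m * (g' + m * g ^ 2) * X + (INR p + 1) / r * (m * g * X))
              + al * (X * Y) + be * r * (g * (X * Y))
    = (INR p + 1) * X * (g' - (- (INR p + 1) / r * g - m * g ^ 2
                               - Y / (INR p + 1) * (al + be * r * g)))).
  { field. repeat split; lra. }
  rewrite E. split.
  - intros H. apply Rmult_integral in H. destruct H as [H | H]; [|lra].
    exfalso. assert (0 < (INR p + 1) * X) by (apply Rmult_lt_0_compat; lra). lra.
  - intros ->. ring.
Qed.

Lemma solution_of_log_profile (p : nat) (m al be f0 : R) (f g : R -> R) :
  0 < m -> log_profile p m al be f0 f g -> (forall r, is_derive f r (g r)) ->
  is_solution (S (S p)) m al be (exp f0) (fun r => exp (f r)).
Proof.
  intros Hm [Cf [Cg [F0 [G0 Hd]]]] Hf.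
  assert (HN : INR (S (S p)) - 1 = INR p + 1) by (rewrite !S_INR; ring).
  assert (Hv : forall x, is_derive (fun r => exp (f r)) x (g x * exp (f x))).
  { intros x. exact (is_derive_comp exp f x _ _ (is_derive_exp (f x)) (Hf x)). }
  assert (Cv : cont (fun r => exp (f r))) by (apply (cont_comp f exp Cf cont_exp)).
  set (g' := fun r => - (INR p + 1) / r * g r - m * g r ^ 2
                      - reaction p m (f r) * (al + be * r * g r)).
  assert (HL : forall M r, 0 < r -> _) by
    (intros M r Hr; exact (derivatives_of_exp_profile (fun r => exp (f r)) f g M r (g' r)
       (filter_forall _ (fun t => eq_refl)) (filter_forall _ Hf) (proj2 (Hd r Hr)))).
  split; [|split; [|split; [|split; [|split]]]].
  - intros r _. apply exp_pos.
  - exists (fun x => g x * exp (f x)). split.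
    + intros x Hx. now apply is_derive_is_derive_in.
    + intros x _ P HP. assert (H := cont_mult g (fun r => exp (f r)) Cg Cv x P HP).
      unfold filtermap, within in *. revert H. now apply filter_imp.
  - intros x Hx. destruct (HL m x Hx) as [H1 [H2 _]]. split.
    + intros i Hi. destruct i as [|[|[|i]]]; [exact I | | exact H2 | lia].
      eexists. apply Hv.
    + apply (continuous_ext_loc _ (fun t => (g' t + g t ^ 2) * exp (f t))).
      * assert (Hpos : locally x (fun t => 0 < t)) by now apply open_gt.
        revert Hpos. apply filter_imp. intros t Ht.
        destruct (HL m t Ht) as [_ [_ [H3 _]]]. symmetry. exact H3.
      * apply (continuous_mult (fun t => g' t + g t ^ 2)); [|apply Cv].
        apply (continuous_plus g' (fun t => g t ^ 2)).
        2:{ apply (cont_comp g (fun y => y ^ 2) Cg), cont_pow. }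
        apply (continuous_minus (fun r => - (INR p + 1) / r * g r - m * g r ^ 2)).
        -- apply (continuous_minus (fun r => - (INR p + 1) / r * g r)).
           ++ apply (continuous_mult (fun r => - (INR p + 1) / r)); [|apply Cg].
              apply (continuous_mult (fun _ => - (INR p + 1))); [apply continuous_const|].
              apply continuous_Rinv. lra.
           ++ apply (cont_mult (fun _ => m)); [apply cont_const|].
              apply (cont_comp g (fun y => y ^ 2) Cg), cont_pow.
        -- apply cont_mult; [apply (cont_comp f (reaction p m) Cf), cont_reaction|].
           apply cont_plus; [apply cont_const|]. apply cont_mult; [|exact Cg].
           apply cont_mult; [apply cont_const | apply cont_id].
  - intros r Hr. destruct (HL m r Hr) as [H1 [_ [_ [H4 H5]]]].
    rewrite H4, H5, (locally_singleton _ _ H1), HN.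
    now apply (ode_log_form p m al be r (f r) (g r) (g' r)).
  - now rewrite F0.
  - apply is_derive_is_derive_in; [lra|].
    replace 0 with (g 0 * exp (f 0)) at 2 by (rewrite G0; ring). apply Hv.
Qed.

(** Composing with max(0, r) turns a function that is continuous on [0, oo) into
    one that is continuous on the line without changing it there. *)
Lemma log_profile_of_solution (p : nat) (m al be eta : R) (u : R -> R) :
  0 < m -> is_solution (S (S p)) m al be eta u ->
  exists f g, log_profile p m al be (ln eta) f g /\ forall r, 0 <= r -> u r = exp (f r).
Proof.
  intros Hm [Hpos [[du [Hdu Cdu]] [HC2 [Hode [Hu0 Hu0']]]]].
  assert (HN : INR (S (S p)) - 1 = INR p + 1) by (rewrite !S_INR; ring).
  set (U := fun r => u (Rmax 0 r)). set (DU := fun r => du (Rmax 0 r)).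
  assert (HUr : forall r, 0 <= r -> U r = u r).
  { intros r Hr. unfold U. now rewrite Rmax_right. }
  assert (HUp : forall r, 0 < U r) by (intros r; apply Hpos, Rmax_l).
  assert (CU : cont U).
  { apply cont_half_line_extension. intros x Hx.
    apply (@filterdiff_continuous_aux R_AbsRing R_NormedModule R_NormedModule _
             (within_filter _ half_line _ _) u); [|apply within_half_line_lim].
    eexists. apply Hdu, Hx. }
  assert (CDU : cont DU) by (apply cont_half_line_extension; exact Cdu).
  assert (Hux : forall r, 0 < r -> is_derive u r (du r)).
  { intros r Hr. apply is_derive_in_is_derive; [exact Hr | apply Hdu; unfold half_line; lra]. }
  set (f := fun r => ln (U r)). set (g := fun r => DU r * / U r).
  assert (Hef : forall r, 0 <= r -> u r = exp (f r)).
  { intros r Hr. unfold f. now rewrite exp_ln, HUr. }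
  assert (Hloc : forall r, 0 < r -> locally r (fun t => 0 < t)) by (intros; now apply open_gt).
  assert (Hfd : forall r, 0 < r -> is_derive f r (g r)).
  { intros r Hr. apply (is_derive_ext_loc (fun t => ln (u t))).
    - generalize (Hloc r Hr). apply filter_imp. intros t Ht. unfold f. rewrite HUr; [reflexivity | lra].
    - assert (Hur : 0 < u r) by (apply Hpos; lra).
      assert (H := is_derive_comp ln u r _ _ (is_derive_ln (u r) Hur) (Hux r Hr)).
      unfold g, DU, U. rewrite Rmax_right by lra. exact H. }
  exists f, g. split; [|exact Hef].
  split; [|split; [|split; [|split]]].
  - intros x. apply (continuous_comp U ln); [apply CU|].
    eapply is_derive_continuous, is_derive_ln, HUp.
  - apply cont_mult; [exact CDU|]. apply cont_inv; [exact CU|].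
    intros x. specialize (HUp x). lra.
  - unfold f. rewrite HUr by lra. now rewrite Hu0.
  - unfold g, DU. rewrite Rmax_left by lra.
    rewrite (is_derive_in_0_unique u (du 0) 0); [ring | | exact Hu0'].
    apply Hdu. unfold half_line. lra.
  - intros r Hr. split; [now apply Hfd|].
    assert (Hur : 0 < u r) by (apply Hpos; lra).
    destruct (HC2 r Hr) as [Hex _]. specialize (Hex 2%nat (le_n 2)).
    destruct Hex as [d2 Hd2]. change (is_derive (Derive u) r d2) in Hd2.
    assert (Hg : exists g', is_derive g r g').
    { eexists. apply (is_derive_ext_loc (fun t => Derive u t * / u t)).
      - generalize (Hloc r Hr). apply filter_imp. intros t Ht. unfold g, DU, U.
        rewrite Rmax_right by lra. f_equal. now apply is_derive_unique, Hux.
      - apply is_derive_prod; [exact Hd2|].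
        apply is_derive_inv; [apply Hux, Hr | lra]. }
    destruct Hg as [g' Hg].
    assert (Hlu : locally r (fun t => u t = exp (f t))).
    { generalize (Hloc r Hr). apply filter_imp. intros t Ht. apply Hef. lra. }
    assert (Hlf : locally r (fun t => is_derive f t (g t))).
    { generalize (Hloc r Hr). apply filter_imp. exact Hfd. }
    destruct (derivatives_of_exp_profile u f g m r g' Hlu Hlf Hg) as [H1 [_ [_ [H4 H5]]]].
    specialize (Hode r Hr).
    rewrite H4, H5, (locally_singleton _ _ H1), HN, (Hef r) in Hode by lra.
    apply ode_log_form in Hode; [|exact Hm | exact Hr]. rewrite <- Hode. exact Hg.
Qed.

Theorem theorem1p2 (n : nat) (m eta alpha beta : R)
    (hn : (3 <= n)%nat)
    (hm0 : 0 < m) (hm : m <= (INR n - 2) / INR n)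
    (heta : 0 < eta)
    (hbeta : 0 < beta) (halpha : alpha <= beta * (INR n - 2) / m) :
  exists v : R -> R,
    is_solution n m alpha beta eta v /\
    (forall u : R -> R, is_solution n m alpha beta eta u ->
      forall r : R, 0 <= r -> u r = v r) /\
    (alpha <> 0 ->
      forall k : R, k = beta / alpha ->
      let w1 := fun r : R => r ^ 2 * Rpower (v r) (2 * k) in
      forall r : R, 0 < r -> ex_derive w1 r /\ 0 < Derive w1 r).
Proof.
  destruct n as [|[|p]]; [lia | lia |].
  assert (HN : INR (S (S p)) - 2 = INR p) by (rewrite !S_INR; ring).
  rewrite HN in halpha.
  assert (Hex : exists f g, log_profile p m alpha beta (ln eta) f g /\
            (forall r, is_derive f r (g r)) /\
            (alpha <> 0 -> forall r, 0 < r -> 0 < 1 + beta / alpha * r * g r)).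
  { destruct (Req_dec alpha 0) as [Ha | Ha].
    - exists (fun _ => ln eta), (fun _ => 0).
      assert (Hc : forall c r : R, is_derive (fun _ : R => c) r 0).
      { intros c r. apply (is_derive_const (V := R_NormedModule)). }
      split; [split; [|split; [|split; [|split]]] | split].
      + apply cont_const.
      + apply cont_const.
      + reflexivity.
      + reflexivity.
      + intros r Hr. split; [apply Hc|].
        replace (- (INR p + 1) / r * 0 - m * 0 ^ 2
                 - reaction p m (ln eta) * (alpha + beta * r * 0)) with 0
          by (rewrite Ha; field; lra).
        apply Hc.
      + apply Hc.
      + intros H. contradiction.
    - assert (Hs : exists s a, (s = 1 \/ s = -1) /\ 0 < a /\ alpha = s * a).
      { destruct (Rlt_le_dec 0 alpha).
        - exists 1, alpha. repeat split; [now left | assumption | ring].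
        - exists (-1), (- alpha). repeat split; [now right | lra | ring]. }
      destruct Hs as [s [a [Hs [Hapos Has]]]].
      assert (Hsm : s * m * (a / beta) <= INR p).
      { replace (s * m * (a / beta)) with (alpha * m / beta) by (rewrite Has; field; lra).
        apply (Rmult_le_reg_r beta); [exact hbeta|].
        replace (alpha * m / beta * beta) with (alpha * m) by (field; lra).
        apply (Rmult_le_compat_r m) in halpha; [|lra].
        replace (beta * INR p / m * m) with (INR p * beta) in halpha by (field; lra).
        exact halpha. }
      destruct (log_profile_exists p m a beta s (ln eta) hm0 Hapos hbeta Hs Hsm)
        as [f [g [Hp [Hd Hpos]]]].
      exists f, g. rewrite Has. split; [exact Hp | split; [exact Hd|]].
      intros _ r Hr. specialize (Hpos r Hr).
      replace (1 + beta / (s * a) * r * g r) with ((a + s * beta * r * g r) / a).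
      + now apply Rdiv_lt_0_compat.
      + destruct Hs as [-> | ->]; field; lra. }
  destruct Hex as [f [g [Hp [Hd Hpos]]]].
  exists (fun r => exp (f r)). split; [|split].
  - rewrite <- (exp_ln eta heta) at 1. now apply (solution_of_log_profile p m alpha beta (ln eta) f g).
  - intros u Hu r Hr.
    destruct (log_profile_of_solution p m alpha beta eta u hm0 Hu) as [f2 [g2 [Hp2 Hu2]]].
    rewrite Hu2 by exact Hr. f_equal.
    exact (log_profile_unique p m alpha beta (ln eta) f2 g2 f g Hp2 Hp ltac:(lra) r Hr).
  - intros Ha k Hk w1 r Hr.
    assert (Hw : is_derive w1 r (2 * r * exp (2 * k * f r) * (1 + beta / alpha * r * g r))).
    { apply (is_derive_ext (fun t => t ^ 2 * exp (2 * k * f t))).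
      { intros t. unfold w1, Rpower. now rewrite ln_exp. }
      assert (H := is_derive_prod _ _ r _ _ (is_derive_power 1 r)
                (is_derive_comp exp (fun t => 2 * k * f t) r _ _
                  (is_derive_exp _) (is_derive_cmult f r (2 * k) _ (Hd r)))).
      replace (2 * r * exp (2 * k * f r) * (1 + beta / alpha * r * g r)) with
        ((INR 1 + 1) * r ^ 1 * exp (2 * k * f r)
         + r ^ 2 * (2 * k * g r * exp (2 * k * f r))).
      - exact H.
      - rewrite Hk. simpl. field. exact Ha. }
    split; [eexists; exact Hw|]. rewrite (is_derive_unique _ _ _ Hw).
    apply Rmult_lt_0_compat; [|now apply Hpos].
    apply Rmult_lt_0_compat; [lra | apply exp_pos].
Qed.
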